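(* Assume Slater's condition: there exists $\widetilde X\in\mathcal S$ with $J_c(\widetilde X)<\bar\rho$. Then there is no duality gap between the primal problem $$\text{minimize}_{X\in\mathcal S}\ J(X)\quad\text{subject to}\quad J_c(X)\le\bar\rho$$ and the dual problem $\text{maximize}_{\mu\ge 0}\ D(\mu)$, where $D(\mu)=\min_{X\in\mathcal S}\mathcal L(X,\mu)$; that is, the optimal values of the two problems are equal.
   Context: Setting. $x_{t+1}=Ax_t+Bu_t+w_t$ with $x_t\in\mathbb R^n$, $u_t\in\mathbb R^m$; $\{w_t\}$ is an i.i.d. sequence with finite fourth moments, mean $\bar w=\mathbb E[w_t]$ and covariance $W=\mathbb E[(w_t-\bar w)(w_t-\bar w)^\top]>0$ (positive definite). $Q$ is positive semi-definite, $R$ is positive definite, $(A,B)$ is controllable and $(A,Q^{1/2})$ is observable. Let $M_3=\mathbb E[(w_t-\bar w)(w_t-\bar w)^\top Q(w_t-\bar w)]$, $m_4=\mathbb E[((w_t-\bar w)^\top Q(w_t-\bar w)-\operatorname{tr}\{WQ\})^2]$, and $\bar\rho=\rho_0-m_4+4\operatorname{tr}\{(WQ)^2\}$, where $\rho_0>0$ is a given risk tolerance. A policy is $X=[K,l]$ with $K\in\mathbb R^{m\times n}$, $l\in\mathbb R^m$, meaning $u_t=-Kx_t+l$. $\mathcal S=\{[K,l]:\rho(A-BK)<1\}$ is the set of stabilizing policies ($\rho(\cdot)$ = spectral radius). For $X\in\mathcal S$, $$J(X)=\lim_{T\to\infty}\tfrac1T\mathbb E\Big[\sum_{t=0}^{T-1}(x_t^\top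 Qx_t+u_t^\top Ru_t)\Big],\qquad J_c(X)=\lim_{T\to\infty}\tfrac1T\mathbb E\Big[\sum_{t=0}^{T-1}(4x_t^\top QWQx_t+4x_t^\top QM_3)\Big].$$ For $\mu\ge0$ the Lagrangian is $\mathcal L(X,\mu)=J(X)+\mu(J_c(X)-\bar\rho)$. *)

(* Defs.v *)
From HB Require Import structures.
From mathcomp Require Import all_boot all_order all_algebra.
From mathcomp Require Import complex.
From mathcomp Require Import all_classical all_reals all_analysis.

Set Implicit Arguments.
Unset Strict Implicit.
Unset Printing Implicit Defensive.
Import Order.TTheory GRing.Theory Num.Theory.
Import numFieldNormedType.Exports.

Local Open Scope classical_set_scope.
Local Open Scope ring_scope.

Section LinearSystems.
Context {R : realType}.

Definition qform {n} (M : 'M[R]_n) (v : 'cV[R]_n) : R := (v^T *m M *m v) 0 0.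

Definition psd {n} (M : 'M[R]_n) : Prop :=
  M^T = M /\ forall v : 'cV[R]_n, 0 <= qform M v.

Definition pd {n} (M : 'M[R]_n) : Prop :=
  M^T = M /\ forall v : 'cV[R]_n, v != 0 -> 0 < qform M v.

(* S = M^(1/2), the unique positive semi-definite square root of M *)
Definition is_sqrtmx {n} (M S : 'M[R]_n) : Prop := psd S /\ S *m S = M.

Definition controllable {n m} (A : 'M[R]_n) (B : 'M[R]_(n, m)) : Prop :=
  \rank (\mxrow_(k < n) (A ^+ k *m B)) = n.

Definition observable {n p} (A : 'M[R]_n) (C : 'M[R]_(p, n)) : Prop :=
  \rank (\mxcol_(k < n) (C *m A ^+ k)) = n.

(* The eigenvalues are the complex ones; for n = 0 there are none, and the
   supremum of the empty set is 0. *)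
Definition spectral_radius {n} (M : 'M[R]_n) : R :=
  sup [set ComplexField.Normc.normc z
      | z in [set z : R[i] | eigenvalue (map_mx (real_complex R) M) z]].

End LinearSystems.

Section RandomVectors.
Context {R : realType} {d : measure_display} {Omega : measurableType d}.
Variable P : probability Omega R.

Definition borel {n} : set (set 'cV[R]_n) := <<s [set U | open U] >>.

Definition random_vector {n} (Y : Omega -> 'cV[R]_n) : Prop :=
  forall E, borel E -> measurable (Y @^-1` E).

Definition independent_seq {n} (w : nat -> Omega -> 'cV[R]_n) : Prop :=
  forall (s : seq nat) (E : nat -> set 'cV[R]_n),
    uniq s -> (forall t, borel (E t)) ->
    P (\bigcap_(t in [set` s]) (w t @^-1` E t)) =
    (\prod_(t <- s) P (w t @^-1` E t))%E.

Definition identically_distributed {n} (w : nat -> Omega -> 'cV[R]_n) : Prop :=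
  forall (s t : nat) (E : set 'cV[R]_n), borel E ->
    P (w s @^-1` E) = P (w t @^-1` E).

Definition iid {n} (w : nat -> Omega -> 'cV[R]_n) : Prop :=
  [/\ forall t, random_vector (w t), independent_seq w
    & identically_distributed w].

(* E|Y|^(2k) < +oo for the Euclidean norm |Y|^2 = Y^T Y *)
Definition finite_even_moment (k : nat) {n} (Y : Omega -> 'cV[R]_n) : Prop :=
  ('E_P[fun om => (qform 1%:M (Y om) ^+ k)%R] < +oo)%E.

(* entrywise expectation *)
Definition Emx {p q} (Y : Omega -> 'M[R]_(p, q)) : 'M[R]_(p, q) :=
  \matrix_(i, j) fine 'E_P[fun om => Y om i j]%E.

Definition centered {n} (Y : Omega -> 'cV[R]_n) : Omega -> 'cV[R]_n :=
  fun om => Y om - Emx Y.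

Definition covmx {n} (Y : Omega -> 'cV[R]_n) : 'M[R]_n :=
  Emx (fun om => centered Y om *m (centered Y om)^T).

Definition M3 {n} (Q : 'M[R]_n) (Y : Omega -> 'cV[R]_n) : 'cV[R]_n :=
  Emx (fun om => centered Y om *m (centered Y om)^T *m Q *m centered Y om).

Definition m4 {n} (Q : 'M[R]_n) (Y : Omega -> 'cV[R]_n) : R :=
  fine 'E_P[fun om =>
    ((qform Q (centered Y om) - \tr (covmx Y *m Q)) ^+ 2)%R]%E.

(* rho-bar *)
Definition risk_bound {n} (Q : 'M[R]_n) (Y : Omega -> 'cV[R]_n) (rho0 : R) : R :=
  rho0 - m4 Q Y + 4 * \tr ((covmx Y *m Q) ^+ 2).

End RandomVectors.

(* A policy is a pair X = (K, l). *)
Definition policy (R : realType) (n m : nat) : Type :=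
  ('M[R]_(m, n) * 'cV[R]_m)%type.

Definition control {R : realType} {n m} (X : policy R n m) (x : 'cV[R]_n) :
  'cV[R]_m := - (X.1 *m x) + X.2.

Definition stabilizing {R : realType} {n m} (A : 'M[R]_n) (B : 'M[R]_(n, m)) :
  set (policy R n m) := [set X | spectral_radius (A - B *m X.1) < 1].

Section RiskConstrainedLQR.
Context {R : realType} {d : measure_display} {Omega : measurableType d}.
Variable P : probability Omega R.
Context {n m : nat}.
Variables (A : 'M[R]_n) (B : 'M[R]_(n, m)) (Q : 'M[R]_n) (Rc : 'M[R]_m).
Variables (x0 : Omega -> 'cV[R]_n) (w : nat -> Omega -> 'cV[R]_n).
Variable rho0 : R.

Fixpoint state (X : policy R n m) (t : nat) (om : Omega) : 'cV[R]_n :=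
  if t is t'.+1 then
    A *m state X t' om + B *m control X (state X t' om) + w t' om
  else x0 om.

(* limit as T -> oo of (1/T) E[sum_(t < T) c t] *)
Definition average_cost (c : nat -> Omega -> R) : \bar R :=
  limn (fun T : nat =>
    ((T%:R^-1)%:E * 'E_P[fun om => (\sum_(t < T) c t om)%R])%E).

Definition J (X : policy R n m) : \bar R :=
  average_cost (fun t om =>
    qform Q (state X t om) + qform Rc (control X (state X t om))).

(* The noise is identically distributed, so its moments are those of w 0. *)
Definition Jc (X : policy R n m) : \bar R :=
  average_cost (fun t om =>
    4 * qform (Q *m covmx P (w 0%N) *m Q) (state X t om)
    + 4 * ((state X t om)^T *m Q *m M3 P Q (w 0%N)) 0 0).

Definition rhobar : R := risk_bound P Q (w 0%N) rho0.

Definition lagrangian (X : policy R n m) (mu : R) : \bar R :=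
  (J X + mu%:E * (Jc X - rhobar%:E))%E.

Definition dual_function (mu : R) : \bar R :=
  ereal_inf [set lagrangian X mu | X in stabilizing A B].

Definition primal_value : \bar R :=
  ereal_inf [set J X | X in
    [set X | stabilizing A B X /\ (Jc X <= rhobar%:E)%E]].

Definition dual_value : \bar R :=
  ereal_sup [set dual_function mu | mu in [set mu : R | 0 <= mu]].

End RiskConstrainedLQR.

(* Main.v *)
(** The averages J and Jc depend on a stabilizing policy [K, l] only through the
    stationary covariance S = F S F^T + W, F = A - B K, and the equilibrium
    (xb, ub) of the mean dynamics.  Both are affine in S and convex quadratic in
    (xb, ub), except for the control cost tr (R K S K^T).  The policies are not
    convex, but two of them can be mixed: take T = a S1 + (1 - a) S2, the gain K
    with K T = a K1 S1 + (1 - a) K2 S2, and the averaged equilibrium.  For every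
    matrix G depending affinely on K, the variance identity
      a G1 S1 G1^T + (1 - a) G2 S2 G2^T - G T G^T
        = a (G1 - G) S1 (G1 - G)^T + (1 - a) (G2 - G) S2 (G2 - G)^T
    has a psd right-hand side.  With G = A - B K it gives T >= F T F^T + W, so K
    is stabilizing and its stationary covariance is below T; with G = K it bounds
    the control cost.  Hence the values (J, Jc) that policies attain or improve
    on form a convex set, and Slater's condition yields a Lagrange multiplier. *)
Require Import Defs.
From mathcomp Require Import all_boot all_order all_algebra.
From mathcomp Require Import complex.
From mathcomp Require Import all_classical all_reals all_analysis.
From mathcomp Require Import measurable_realfun ring lra.

Set Implicit Arguments.
Unset Strict Implicit.
Unset Printing Implicit Defensive.
Import Order.TTheory GRing.Theory Num.Theory.
Import numFieldNormedType.Exports.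

Local Open Scope classical_set_scope.
Local Open Scope ring_scope.

(** * Spectral radius and matrix powers *)

Section Stability.
Context {R : realType}.
Implicit Types (n m p : nat).
Local Notation normc := ComplexField.Normc.normc.

Lemma normc_ge0 (z : R[i]) : 0 <= normc z.
Proof. by case: z => a b /=; exact: sqrtr_ge0. Qed.

Lemma ler_normcD (x y : R[i]) : normc (x + y) <= normc x + normc y.
Proof. exact: (@le_normcD R x y). Qed.

(** The constant [D = normc (u 0) + C / (r - normc z)] satisfies [C + normc z * D <= r * D], so the
    bound [D * r ^+ k] reproduces itself under the recurrence. *)
Lemma geometric_recurrence (u : nat -> R[i]) (v : nat -> R[i]) (z : R[i])
    (r C : R) : normc z < r -> 0 <= C ->
  (forall k, normc (v k) <= C * r ^+ k) ->
  (forall k, u k.+1 = v k + z * u k) ->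
  forall k, normc (u k) <= (normc (u 0%N) + C / (r - normc z)) * r ^+ k.
Proof.
move=> zr C0 hv hu.
have dz : 0 < r - normc z by rewrite subr_gt0.
have r0 : 0 < r by rewrite (le_lt_trans _ zr)// normc_ge0.
set D := _ + _.
have D0 : 0 <= D by rewrite addr_ge0// ?normc_ge0// divr_ge0// ltW.
have CD : C <= (r - normc z) * D.
  rewrite mulrDr mulrCA mulfV ?gt_eqF// mulr1 lerDr mulr_ge0// ?normc_ge0//.
  exact: ltW.
elim=> [|k IH]; first by rewrite expr0 mulr1 lerDl divr_ge0// ltW.
rewrite hu; apply: le_trans (ler_normcD _ _) _.
rewrite ComplexField.Normc.normcM.
apply: le_trans (lerD (hv k) (ler_wpM2l (normc_ge0 z) IH)) _.
rewrite exprS !mulrA -mulrDl; apply: ler_wpM2r; first exact: exprn_ge0 (ltW r0).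
  by apply: le_trans (lerD CD (lexx _)) _; rewrite mulrBl addrNK mulrC.
Qed.

(* Peeling one linear factor off the annihilating product turns [N *m F ^+ k]
   into a first order recurrence driven by [N *m (F - z%:M) *m F ^+ k]. *)
Lemma annihilated_powers_bound n (F N : 'M[R[i]]_n) (s : seq R[i]) (r : R) :
  (forall z, z \in s -> normc z < r) ->
  N *m \prod_(z <- s) (F - z%:M) = 0 ->
  exists2 C, 0 <= C & forall k i j, normc ((N *m F ^+ k) i j) <= C * r ^+ k.
Proof.
elim: s N => [|z s IH] N hs.
  rewrite big_nil mulmx1 => ->; exists 0 => // k i j.
  by rewrite mul0mx mxE ComplexField.Normc.normc0 mul0r.
rewrite big_cons -mulmxE mulmxA => /IH[|C C0 hC].
  by move=> y ys; apply: hs; rewrite inE ys orbT.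
have zr : normc z < r by apply: hs; rewrite inE eqxx.
pose D := \sum_i \sum_j normc (N i j).
have ND i j : normc (N i j) <= D.
  rewrite /D (bigD1 i)//= (bigD1 j)//= -addrA lerDl addr_ge0//.
    by apply: sumr_ge0 => *; exact: normc_ge0.
  by apply: sumr_ge0 => *; apply: sumr_ge0 => *; exact: normc_ge0.
have D0 : 0 <= D by do 2!apply: sumr_ge0 => ? _; exact: normc_ge0.
have dz : 0 < r - normc z by rewrite subr_gt0.
exists (D + C / (r - normc z)); first by rewrite addr_ge0// divr_ge0// ltW.
move=> k i j.
have r0 : 0 < r by rewrite (le_lt_trans _ zr)// normc_ge0.
have := @geometric_recurrence (fun k => (N *m F ^+ k) i j)
  (fun k => (N *m (F - z%:M) *m F ^+ k) i j) z r C zr C0 (fun k => hC k i j).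
move=> H; apply: le_trans (H _ k) _.
  move=> l; rewrite exprS -mulmxE mulmxA mulmxBr mulmxBl mul_mx_scalar.
  by rewrite -scalemxAl !mxE subrK.
by rewrite expr0 mulmx1 ler_wpM2r ?exprn_ge0 ?(ltW r0)// lerD2r.
Qed.

(** * Entrywise limits of matrices *)

Lemma cvg_sumr (I : finType) (f : I -> nat -> R) (l : I -> R) :
  (forall i, f i @ \oo --> l i) ->
  (fun t => \sum_i f i t) @ \oo --> \sum_i l i.
Proof.
move=> fl; elim: (index_enum I) => [|i s IH].
  by rewrite big_nil; under eq_fun do rewrite big_nil; exact: cvg_cst.
rewrite big_cons; under eq_fun do rewrite big_cons.
by apply: cvgD; [exact: fl|exact: IH].
Qed.

Definition mx_cvg m n (M : nat -> 'M[R]_(m, n)) (L : 'M[R]_(m, n)) :=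
  forall i j, (fun t => M t i j) @ \oo --> L i j.

Lemma mx_cvg_cst m n (M : 'M[R]_(m, n)) : mx_cvg (fun=> M) M.
Proof. by move=> i j; exact: cvg_cst. Qed.

Lemma mx_cvgD m n (M N : nat -> 'M[R]_(m, n)) L K :
  mx_cvg M L -> mx_cvg N K -> mx_cvg (fun t => M t + N t) (L + K).
Proof.
move=> ML NK i j; rewrite mxE; under eq_fun do rewrite mxE.
by apply: cvgD; [exact: ML|exact: NK].
Qed.

Lemma mx_cvgN m n (M : nat -> 'M[R]_(m, n)) L :
  mx_cvg M L -> mx_cvg (fun t => - M t) (- L).
Proof.
move=> ML i j; rewrite mxE; under eq_fun do rewrite mxE.
by apply: cvgN; exact: ML.
Qed.

Lemma mx_cvg_tr m n (M : nat -> 'M[R]_(m, n)) L :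
  mx_cvg M L -> mx_cvg (fun t => (M t)^T) L^T.
Proof.
by move=> ML i j; rewrite mxE; under eq_fun do rewrite mxE; exact: ML.
Qed.

Lemma mx_cvgM m n p (M : nat -> 'M[R]_(m, n)) (N : nat -> 'M[R]_(n, p)) L K :
  mx_cvg M L -> mx_cvg N K -> mx_cvg (fun t => M t *m N t) (L *m K).
Proof.
move=> ML NK i j; rewrite mxE; under eq_fun do rewrite mxE.
apply: cvg_sumr => k.
by apply: cvgM; [exact: ML|exact: NK].
Qed.

Lemma mx_cvg_unique m n (M : nat -> 'M[R]_(m, n)) L K :
  mx_cvg M L -> mx_cvg M K -> L = K.
Proof.
move=> ML MK; apply/matrixP => i j.
exact: (cvg_unique _ (ML i j) (MK i j)).
Qed.

Lemma mx_cvg_tr_trace n (M : nat -> 'M[R]_n) L :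
  mx_cvg M L -> (fun t => \tr (M t)) @ \oo --> \tr L.
Proof. by move=> ML; apply: cvg_sumr => i; exact: ML. Qed.

(** The second factor need not converge. This serves the correlation between initial state and
    noise, for which only a bound is available. *)
Lemma mx_cvg0_bounded m n p (M : nat -> 'M[R]_(m, n))
    (N : nat -> 'M[R]_(n, p)) (C : R) :
  mx_cvg M 0 -> (forall t i j, `|N t i j| <= C) ->
  mx_cvg (fun t => M t *m N t) 0.
Proof.
move=> M0 NC i j; rewrite mxE; under eq_fun do rewrite mxE.
suff : (fun t => \sum_k M t i k * N t k j) @ \oo --> \sum_(k < n) (0 : R).
  by rewrite big1.
apply: cvg_sumr => k; apply: norm_cvg0.
apply: (@squeeze_cvgr _ _ _ _ (fun=> 0) (fun t => `|M t i k| * C)).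
- by near=> t; rewrite normr_ge0/= normrM ler_wpM2l.
- exact: cvg_cst.
- rewrite -(mul0r C); apply: cvgMl.
  by rewrite -(normr0 R); apply: cvg_norm; move: (M0 i k); rewrite mxE.
Unshelve. all: by end_near.
Qed.

(** Stability as a statement about real matrices: the Lyapunov arguments iterate [F] and pass to the
    limit without eigenvalues. *)
Definition powers_vanish n (F : 'M[R]_n) := mx_cvg (fun k => F ^+ k) 0.

Lemma char_poly_split n (F : 'M[R[i]]_n) :
  exists2 s : seq R[i], (forall z, z \in s = eigenvalue F z)
    & \prod_(z <- s) (F - z%:M) = 0.
Proof.
have [s sE] := closed_field_poly_normal (char_poly F).
exists s.
  move=> z; rewrite eigenvalue_root_char sE rootZ ?root_prod_XsubC//.
  by rewrite (monicP (char_poly_monic F)) oner_eq0.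
(* Cayley-Hamilton is applied in positive size; in size 0 all matrices coincide. *)
case: n F sE => [F _|n F sE]; first by apply/matrixP => -[].
have := Cayley_Hamilton F.
rewrite sE (monicP (char_poly_monic F)) scale1r rmorph_prod /= => <-.
by apply: eq_bigr => z _; rewrite rmorphB /= horner_mx_X horner_mx_C.
Qed.

Lemma map_mxX n (F : 'M[R]_n) k :
  map_mx (real_complex R) (F ^+ k) = (map_mx (real_complex R) F) ^+ k.
Proof.
elim: k => [|k IH]; first by rewrite !expr0 map_mx1.
by rewrite !exprS -!mulmxE map_mxM IH.
Qed.

(** The spectrum is finite, being listed by the roots [s] of the characteristic polynomial, so
    strict bounds on the single eigenvalues yield one bound [r < 1], and the supremum stays strictly
    below 1. *)
Lemma spectral_radius_lt1P n (F : 'M[R]_n) :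
  spectral_radius F < 1 <->
  (forall z, eigenvalue (map_mx (real_complex R) F) z -> normc z < 1).
Proof.
have [s sE _] := char_poly_split (map_mx (real_complex R) F).
rewrite /spectral_radius; set S := (X in sup X).
have ubS : ubound S (\sum_(z <- s) normc z).
  move=> _ [z /= ez <-]; have : z \in s by rewrite sE.
  move=> zs; rewrite (big_rem z)//= lerDl; apply: sumr_ge0 => *.
  exact: normc_ge0.
split=> [S1 z ez|H].
  apply: le_lt_trans S1; apply: sup_upper_bound; last by exists z.
  by split; [exists (normc z), z|exists (\sum_(z <- s) normc z)].
have [r r1 hr] : exists2 r, r < 1 & forall z, z \in s -> normc z <= r.
  have : forall z, z \in s -> normc z < 1 by move=> z; rewrite sE => /H.
  elim: s {sE ubS} => [_|z s IH hs]; first by exists 0; rewrite ?ltr01.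
  have [y ys|r r1 hr] := IH; first by apply: hs; rewrite inE ys orbT.
  exists (Num.max r (normc z)).
    by rewrite gt_max r1 hs// inE eqxx.
  move=> y; rewrite inE => /orP[/eqP->|/hr yr].
    by rewrite le_max lexx orbT.
  by rewrite le_max yr.
(* An empty spectrum has supremum 0 by convention. *)
have [->|/set0P S0] := eqVneq S set0; first by rewrite sup0 ltr01.
apply: le_lt_trans r1; apply: ge_sup => // _ [z /= ez <-].
by apply: hr; rewrite sE.
Qed.

(** With [r < 1] strictly above all moduli, [annihilated_powers_bound] for [N = 1%:M] bounds the
    entries of [F ^+ k] by [C * r ^+ k]. Cayley-Hamilton replaces a Jordan form. *)
Lemma spectral_radius_powers_vanish n (F : 'M[R]_n) :
  spectral_radius F < 1 -> powers_vanish F.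
Proof.
move=> /spectral_radius_lt1P H i j; rewrite mxE.
have [s sE s0] := char_poly_split (map_mx (real_complex R) F).
have [r [r0 r1 hr]] : exists r, [/\ 0 <= r, r < 1 & forall z, z \in s -> normc z < r].
  have : forall z, z \in s -> normc z < 1 by move=> z; rewrite sE => /H.
  elim: s {sE s0} => [_|z s IH hs]; first by exists 0; rewrite ?ltr01.
  have [y ys|r [r0 r1 hr]] := IH; first by apply: hs; rewrite inE ys orbT.
  have z1 : normc z < 1 by rewrite hs// inE eqxx.
  (* The midpoint of [normc z] and 1 keeps both inequalities strict, as the geometric bound divides
     by [r - normc z]. *)
  exists (Num.max r ((normc z + 1) / 2)); split.
  - by rewrite le_max r0.
  - by rewrite gt_max r1; lra.
  move=> y; rewrite inE => /orP[/eqP->|/hr yr].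
    by rewrite lt_max; apply/orP; right; lra.
  by rewrite lt_max yr.
have [|C C0 hC] := @annihilated_powers_bound _ (map_mx (real_complex R) F) 1%:M s r hr.
  by rewrite s0 mulmx0.
apply: norm_cvg0; apply: (@squeeze_cvgr _ _ _ _ (fun=> 0) (fun k => C * r ^+ k)).
- near=> k; rewrite normr_ge0/=.
  have := hC k i j; rewrite mul1mx -map_mxX mxE /= expr0n/= addr0.
  by rewrite sqrtr_sqr.
- exact: cvg_cst.
- rewrite -(mulr0 C); apply: cvgMr; apply: cvg_expr; rewrite ger0_norm//.
Unshelve. all: by end_near.
Qed.

End Stability.
Arguments mx_cvg_cst {R m n} M.

(** * Lyapunov equations *)

Section Lyapunov.
Context {R : realType}.
Implicit Types (n m p : nat).

Lemma unitmx_inj n (M : 'M[R]_n) :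
  (forall u : 'rV_n, u *m M = 0 -> u = 0) -> M \in unitmx.
Proof.
move=> inj; rewrite -row_free_unit -kermx_eq0; apply/eqP/row_matrixP => i.
rewrite row0; apply: inj; apply/sub_kermxP; exact: row_sub.
Qed.

(** A row vector killed by [1%:M - F] is fixed by every power of [F], hence is 0. The inverse
    provides the equilibrium of the mean dynamics. *)
Lemma powers_vanish_unit n (F : 'M[R]_n) :
  powers_vanish F -> (1%:M - F) \in unitmx.
Proof.
move=> F0; apply: unitmx_inj => u /eqP.
rewrite mulmxBr mulmx1 subr_eq0 => /eqP uF.
have uFk k : u *m F ^+ k = u.
  by elim: k => [|k IH]; rewrite ?expr0 ?mulmx1// exprS -mulmxE mulmxA -uF.
have := mx_cvgM (mx_cvg_cst u) F0; under eq_fun do rewrite uFk.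
by rewrite mulmx0 => /(mx_cvg_unique (mx_cvg_cst u)).
Qed.

(** If [X] is the covariance of a random vector, this is the covariance of its image under [F]. *)
Definition congr_mx m n (F : 'M[R]_(m, n)) (X : 'M[R]_n) : 'M[R]_m :=
  F *m X *m F^T.

Lemma congr_mxA m n p (F : 'M[R]_(m, n)) (G : 'M[R]_(n, p)) X :
  congr_mx F (congr_mx G X) = congr_mx (F *m G) X.
Proof. by rewrite /congr_mx trmx_mul !mulmxA. Qed.

Lemma congr_mxB m n (F : 'M[R]_(m, n)) X Y :
  congr_mx F (X - Y) = congr_mx F X - congr_mx F Y.
Proof. by rewrite /congr_mx mulmxBr mulmxBl. Qed.

Lemma trmx_congr m n (F : 'M[R]_(m, n)) X : (congr_mx F X)^T = congr_mx F X^T.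
Proof. by rewrite /congr_mx !trmx_mul trmxK mulmxA. Qed.

Lemma congr_powers_cvg0 n (F X : 'M[R]_n) :
  powers_vanish F -> mx_cvg (fun k => congr_mx (F ^+ k) X) 0.
Proof.
move=> F0; have := mx_cvgM (mx_cvgM F0 (mx_cvg_cst X)) (mx_cvg_tr F0).
by rewrite trmx0 mulmx0.
Qed.

Lemma lyapunov_inj n (F X : 'M[R]_n) :
  powers_vanish F -> X = congr_mx F X -> X = 0.
Proof.
move=> F0 XE.
have XEk k : congr_mx (F ^+ k) X = X.
  elim: k => [|k IH]; first by rewrite expr0 /congr_mx trmx1 mulmx1 mul1mx.
  by rewrite exprS -mulmxE -congr_mxA IH -XE.
have := congr_powers_cvg0 X F0; under eq_fun do rewrite XEk.
exact: (mx_cvg_unique (mx_cvg_cst X)).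
Qed.

(** By [lyapunov_inj] the operator [X - congr_mx F X] is injective on a finite-dimensional space,
    hence onto. [L] is its matrix acting on vectorized [X]. *)
Lemma lyapunov_exists n (F W : 'M[R]_n) :
  powers_vanish F -> exists X, X = congr_mx F X + W.
Proof.
move=> F0; pose L := 1%:M - lin_mulmx F *m lin_mulmxr F^T.
have LE (X : 'M[R]_n) : mxvec X *m L = mxvec (X - congr_mx F X).
  by rewrite mulmxBr mulmx1 mulmxA !mul_vec_lin /= linearB.
have Lu : L \in unitmx.
  apply: unitmx_inj => u; rewrite -(vec_mxK u) LE => /(canRL mxvecK).
  rewrite linear0 => /eqP; rewrite subr_eq0 => /eqP /(lyapunov_inj F0) ->.
  by rewrite linear0.
exists (vec_mx (mxvec W *m invmx L)); set X := vec_mx _.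
have : mxvec X *m L = mxvec W by rewrite vec_mxK mulmxKV.
by rewrite LE => /(can_inj mxvecK) <-; rewrite addrC subrK.
Qed.

Lemma qform_congr m n (F : 'M[R]_(m, n)) X v :
  qform (congr_mx F X) v = qform X (F^T *m v).
Proof. by rewrite /qform /congr_mx trmx_mul trmxK !mulmxA. Qed.

Lemma qformD n (M N : 'M[R]_n) v : qform (M + N) v = qform M v + qform N v.
Proof. by rewrite /qform mulmxDr mulmxDl mxE. Qed.

Lemma qformN n (M : 'M[R]_n) v : qform (- M) v = - qform M v.
Proof. by rewrite /qform mulmxN mulNmx mxE. Qed.

Lemma qformZ n a (M : 'M[R]_n) v : qform (a *: M) v = a * qform M v.
Proof. by rewrite /qform -scalemxAr -scalemxAl mxE. Qed.

Lemma psd_congr m n (F : 'M[R]_(m, n)) X : psd X -> psd (congr_mx F X).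
Proof.
move=> [Xs X0]; split; first by rewrite trmx_congr Xs.
by move=> v; rewrite qform_congr.
Qed.

Lemma psdD n (M N : 'M[R]_n) : psd M -> psd N -> psd (M + N).
Proof.
move=> [Ms M0] [Ns N0]; split; first by rewrite linearD /= Ms Ns.
by move=> v; rewrite qformD addr_ge0.
Qed.

Lemma psdZ n a (M : 'M[R]_n) : 0 <= a -> psd M -> psd (a *: M).
Proof.
move=> a0 [Ms M0]; split; first by rewrite linearZ /= Ms.
by move=> v; rewrite qformZ mulr_ge0.
Qed.

Lemma pd_psd n (M : 'M[R]_n) : pd M -> psd M.
Proof.
move=> [Ms M0]; split=> // v; have [->|/M0/ltW//] := eqVneq v 0.
by rewrite /qform mulmx0 mxE.
Qed.

Lemma psd_pdD n (M N : 'M[R]_n) : psd M -> pd N -> pd (M + N).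
Proof.
move=> [Ms M0] [Ns N0]; split; first by rewrite linearD /= Ms Ns.
by move=> v v0; rewrite qformD ltr_wpDl// N0.
Qed.

Lemma pd_unitmx n (M : 'M[R]_n) : pd M -> M \in unitmx.
Proof.
move=> [Ms M0]; apply: unitmx_inj => u uM; apply/eqP/negPn/negP => u0.
have := M0 u^T; rewrite /qform trmxK uM mul0mx mxE ltxx => H.
by suff /H : u^T != 0 by []; rewrite trmx_eq0.
Qed.

(** The antisymmetric part of [Y] solves the homogeneous equation, so it vanishes. The numbers
    [qform (congr_mx (F ^+ k) Y) v] decrease in [k] and tend to 0, so the first of them,
    [qform Y v], is nonnegative. Applied to differences, this compares solutions of Lyapunov
    inequalities. *)
Lemma lyapunov_psd n (F Y : 'M[R]_n) :
  powers_vanish F -> psd (Y - congr_mx F Y) -> psd Y.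
Proof.
move=> F0 [Ds D0]; split.
  apply/eqP; rewrite -subr_eq0; apply/eqP; apply: (lyapunov_inj F0).
  move: Ds; rewrite linearB /= trmx_congr => Ds.
  rewrite congr_mxB -{1}(subrK (congr_mx F Y^T) Y^T) Ds addrAC.
  by rewrite [Y - _]addrC addrK addrC.
move=> v.
have mono k : qform (congr_mx (F ^+ k) Y) v <= qform Y v.
  elim: k => [|k IH].
    by rewrite expr0 /congr_mx trmx1 mulmx1 mul1mx.
  apply: le_trans IH; rewrite exprSr -mulmxE -congr_mxA.
  rewrite -subr_ge0 -qformN -qformD -congr_mxB qform_congr; exact: D0.
have := mx_cvgM (mx_cvgM (mx_cvg_cst v^T) (congr_powers_cvg0 Y F0)) (mx_cvg_cst v).
move=> /(_ 0 0); rewrite mulmx0 mul0mx mxE => lim0.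
by rewrite -(cvg_lim _ lim0)//; apply: limr_le; [exact: cvgP lim0|exact: nearW].
Qed.

(** On a left eigenvector for [z], the Hermitian form of [S] is multiplied by [|z|^2] under [F];
    strict decrease forces [|z| < 1]. The computation is carried out on real and imaginary parts. *)
Lemma lyapunov_stable n (F S : 'M[R]_n) :
  pd S -> pd (S - congr_mx F S) -> spectral_radius F < 1.
Proof.
move=> [Ss S0] [_ D0]; apply/spectral_radius_lt1P => z /eigenvalueP[u uF u0].
pose a := map_mx (@complex.Re R) u; pose b := map_mx (@complex.Im R) u.
pose x := complex.Re z; pose y := complex.Im z.
have aF : a *m F = x *: a - y *: b.
  apply/rowP => j; have /rowP/(_ j)/(congr1 (@complex.Re R)) := uF.
  rewrite !mxE raddf_sum/= => H.
  transitivity (\sum_i complex.Re (u 0 i * map_mx (real_complex R) F i j)).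
    by apply: eq_bigr => i _; rewrite !mxE; case: (u 0 i) => p q /=; ring.
  by rewrite H /x /y; case: z {uF x y H} => zx zy; case: (u 0 j).
have bF : b *m F = x *: b + y *: a.
  apply/rowP => j; have /rowP/(_ j)/(congr1 (@complex.Im R)) := uF.
  rewrite !mxE raddf_sum/= => H.
  transitivity (\sum_i complex.Im (u 0 i * map_mx (real_complex R) F i j)).
    by apply: eq_bigr => i _; rewrite !mxE; case: (u 0 i) => p q /=; ring.
  by rewrite H /x /y; case: z {uF x y H aF} => zx zy; case: (u 0 j).
have [s0 d0] : 0 < qform S a^T + qform S b^T /\
    0 < qform (S - congr_mx F S) a^T + qform (S - congr_mx F S) b^T.
  have : (a^T != 0) || (b^T != 0).
    apply: contraNT u0; rewrite negb_or !negbK !trmx_eq0 => /andP[/eqP a0 /eqP b0].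
    apply/eqP/rowP => j; rewrite mxE; apply/eqP; rewrite eq_complex.
    move: a0 b0 => /rowP/(_ j) + /rowP/(_ j); rewrite !mxE => -> ->.
    by rewrite /= !eqxx.
  have P T (v : 'cV_n) : (forall v, v != 0 -> 0 < qform T v) -> 0 <= qform T v.
    by move=> T0; have [->|/T0/ltW//] := eqVneq v 0; rewrite /qform mulmx0 mxE.
  move=> /orP[v0|v0]; split; [apply: ltr_pwDl|apply: ltr_pwDl
    |apply: ltr_wpDl|apply: ltr_wpDl];
    by [exact: S0|exact: D0|exact: P S0|exact: P D0].
have bil (c d : R) (e f : 'rV_n) : qform S (c *: e + d *: f)^T =
    c ^+ 2 * qform S e^T + d ^+ 2 * qform S f^T + (c * d *+ 2) * (e *m S *m f^T) 0 0.
  have fe : (f *m S *m e^T) 0 0 = (e *m S *m f^T) 0 0.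
    by rewrite -[LHS]trace_mx11 -mxtrace_tr !trmx_mul trmxK Ss trace_mx11 mulmxA.
  rewrite /qform !trmxK linearD /= !linearZ /= !mulmxDl !mulmxDr -!scalemxAl.
  rewrite -!scalemxAr; move: fe; rewrite !mxE => ->; ring.
move: d0; rewrite !qformD !qformN !qform_congr -!trmx_mul aF bF.
rewrite -scaleNr !bil => d0.
have -> : ComplexField.Normc.normc z = Num.sqrt (x ^+ 2 + y ^+ 2).
  by rewrite /x /y; case: z {uF x y aF bF d0}.
(* The mixed terms agree by symmetry and enter with opposite signs; what remains in [d0] is
   [1 - x ^+ 2 - y ^+ 2] times the quantity in [s0]. *)
have fe : (b *m S *m a^T) 0 0 = (a *m S *m b^T) 0 0.
  by rewrite -[LHS]trace_mx11 -mxtrace_tr !trmx_mul trmxK Ss trace_mx11 mulmxA.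
rewrite fe in d0.
rewrite -sqrtr1 ltr_sqrt//.
move: s0 d0; set A := qform _ _; set B := qform _ _ => s0 d0.
rewrite -subr_gt0 -(pmulr_lgt0 _ s0).
by nra.
Qed.

End Lyapunov.

(** * Mixing two stabilizing gains *)

Section TracePsd.
Context {R : realType}.
Implicit Types (n m p : nat).

Lemma qform_scaleD n (M : 'M[R]_n) (x : R) (e f : 'cV[R]_n) : M^T = M ->
  qform M (x *: e + f) =
    x ^+ 2 * qform M e + 2 * x * (e^T *m M *m f) 0 0 + qform M f.
Proof.
move=> Ms; have fe : (f^T *m M *m e) 0 0 = (e^T *m M *m f) 0 0.
  by rewrite -[LHS]trace_mx11 -mxtrace_tr !trmx_mul trmxK Ms trace_mx11 mulmxA.
rewrite /qform [_^T]linearD /= [(_ *: _)^T]linearZ /= !mulmxDl !mulmxDr -!scalemxAl -!scalemxAr.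
by move: fe; rewrite !mxE => ->; ring.
Qed.

Lemma delta_mulmx n p (i : 'I_n) (M : 'M[R]_(n, p)) :
  (delta_mx i 0 : 'cV_n)^T *m M = row i M.
Proof. by rewrite trmx_delta rowE. Qed.

Lemma qform_delta n (M : 'M[R]_n) i : qform M (delta_mx i 0) = M i i.
Proof. by rewrite /qform delta_mulmx -colE !mxE. Qed.

Lemma psd_row0 n (M : 'M[R]_n) i : psd M -> M i i = 0 -> forall j, M i j = 0.
Proof.
move=> [Ms M0] Mii j; apply/eqP/negPn/negP => Mij.
(* With a zero diagonal entry the form is affine in the first coefficient; this choice gives it the
   value -1. *)
have := M0 (- (M j j + 1) / (2 * M i j) *: delta_mx i 0 + delta_mx j 0).
rewrite qform_scaleD// !qform_delta Mii mulr0 add0r delta_mulmx -colE !mxE.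
have -> : 2 * (- (M j j + 1) / (2 * M i j)) * M i j = - (M j j + 1).
  by field.
lra.
Qed.

Lemma mxtrace_rank1 n (D : 'M[R]_n) (u : 'cV[R]_n) :
  \tr (u *m u^T *m D) = qform D u.
Proof. by rewrite -mulmxA mxtrace_mulC trace_mx11. Qed.

(* Cholesky elimination: subtracting [a^-1 *: (u *m u^T)], where [u] is column
   [k] of [M] and [a] its diagonal entry, clears row [k] and keeps [M] psd. *)
Lemma mxtrace_psd_ge0 n (M D : 'M[R]_n) : psd M -> psd D -> 0 <= \tr (M *m D).
Proof.
move=> Mp Dp.
suff elimrows d k : (k + d = n)%N -> forall M : 'M[R]_n, psd M ->
    (forall (i : 'I_n) j, (i < k)%N -> M i j = 0) -> 0 <= \tr (M *m D).
  exact: (elimrows n 0%N).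
elim: d k => [|d IH] k kd {Mp}M Mp Mk.
  have -> : M = 0.
    by apply/matrixP => i j; rewrite mxE Mk//; move: kd; rewrite addn0 => ->.
  by rewrite mul0mx mxtrace0.
have kn : (k < n)%N by rewrite -kd addnS ltnS leq_addr.
pose i0 := Ordinal kn; pose a := M i0 i0; pose u := col i0 M.
have [Ms M0] := Mp.
have a0 : 0 <= a by rewrite /a -qform_delta.
have kdS : (k.+1 + d = n)%N by rewrite addSn -addnS.
have [aE|aN] := eqVneq a 0.
  apply: (IH k.+1) => // i j; rewrite ltnS leq_eqVlt => /orP[/eqP ik|/Mk//].
  by have -> : i = i0; [exact/val_inj|exact: psd_row0].
have {a0 aN} a0 : 0 < a by rewrite lt_neqAle eq_sym aN.
pose M' := M - a^-1 *: (u *m u^T).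
(* Completing the square: [qform M' v] is the minimum of the form of [M] over the line through [v]
   in direction [i0], hence nonnegative. *)
have qM' v : qform M' v = qform M (- (a^-1 * (u^T *m v) 0 0) *: delta_mx i0 0 + v).
  rewrite qform_scaleD// qform_delta delta_mulmx qformD qformN qformZ.
  have -> : row i0 M = u^T by rewrite /u tr_col Ms.
  have -> : qform (u *m u^T) v = ((u^T *m v) 0 0) ^+ 2.
    rewrite /qform mulmxA -mulmxA mxE big_ord1 -[v^T *m u]trmxK trmx_mul trmxK.
    by rewrite mxE expr2.
  rewrite -/a; field; exact: lt0r_neq0.
have M'p : psd M'.
  split; last by move=> v; rewrite qM'.
  by rewrite linearB /= Ms linearZ /= trmx_mul trmxK.
have -> : M = M' + a^-1 *: (u *m u^T) by rewrite subrK.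
rewrite mulmxDl mxtraceD -scalemxAl mxtraceZ mxtrace_rank1.
apply: addr_ge0; last by rewrite mulr_ge0 ?invr_ge0 ?(ltW a0)//; apply Dp.
apply: (IH k.+1) => // i j ik; rewrite !mxE big_ord1 !mxE.
move: ik; rewrite ltnS leq_eqVlt => /orP[/eqP ik|ik].
  have -> : i = i0 by exact/val_inj.
  by rewrite -/a mulKf ?gt_eqF// -[in X in _ - X]Ms mxE subrr.
by rewrite !(Mk i)// mul0r mulr0 subrr.
Qed.

Lemma qform_scale n (M : 'M[R]_n) (x : R) e :
  qform M (x *: e) = x ^+ 2 * qform M e.
Proof.
by rewrite /qform [(_ *: _)^T]linearZ /= -!scalemxAl -scalemxAr !mxE mulrA.
Qed.

(** The gap between the two sides is [a * (1 - a)] times the form at [x - y]. *)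
Lemma qform_convex n (M : 'M[R]_n) (a : R) x y : psd M -> 0 <= a -> a <= 1 ->
  qform M (a *: x + (1 - a) *: y) <= a * qform M x + (1 - a) * qform M y.
Proof.
move=> [Ms M0] a0 a1.
have H : 0 <= a * (1 - a) * qform M (-1 *: y + x).
  by rewrite !mulr_ge0// subr_ge0.
have yx : (y^T *m M *m x) 0 0 = (x^T *m M *m y) 0 0.
  by rewrite -[LHS]trace_mx11 -mxtrace_tr !trmx_mul trmxK Ms trace_mx11 mulmxA.
move: yx H; rewrite !qform_scaleD// qform_scale -scalemxAr !mxE => ->; lra.
Qed.

End TracePsd.

(** * Convexity of stationary covariances under mixing of gains *)

Section Convexity.
Context {R : realType}.
Variables (n m : nat) (A : 'M[R]_n) (B : 'M[R]_(n, m)) (W : 'M[R]_n).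
Hypothesis W_pd : pd W.

(** Since [G *m S] is the weighted mean of [G1 *m S1] and [G2 *m S2], the mixed terms combine and
    the gap is the weighted sum of [congr_mx (G1 - G) S1] and [congr_mx (G2 - G) S2]. *)
Lemma weighted_congr p (G G1 G2 : 'M[R]_(p, n)) (S S1 S2 : 'M[R]_n) (a : R) :
  0 <= a -> a <= 1 -> psd S1 -> psd S2 -> S^T = S ->
  S = a *: S1 + (1 - a) *: S2 ->
  G *m S = a *: (G1 *m S1) + (1 - a) *: (G2 *m S2) ->
  psd (a *: congr_mx G1 S1 + (1 - a) *: congr_mx G2 S2 - congr_mx G S).
Proof.
move=> a0 a1 S1p S2p Ss SE GS.
have -> : a *: congr_mx G1 S1 + (1 - a) *: congr_mx G2 S2 - congr_mx G S =
    a *: congr_mx (G1 - G) S1 + (1 - a) *: congr_mx (G2 - G) S2.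
  have expand b (H : 'M[R]_(p, n)) (T : 'M[R]_n) : b *: congr_mx (H - G) T =
      b *: congr_mx H T - (b *: (H *m T)) *m G^T
      - G *m (b *: (T *m H^T)) + G *m (b *: T) *m G^T.
    rewrite /congr_mx [_^T]linearB /= !(mulmxBl, mulmxBr).
    rewrite -!(scalemxAl, scalemxAr) !mulmxA !scalerBr.
    by rewrite opprB addrA addrAC (addrAC (b *: _)).
  have SG : S *m G^T = a *: (S1 *m G1^T) + (1 - a) *: (S2 *m G2^T).
    rewrite -{1}Ss -trmx_mul GS linearD /= !linearZ /= !trmx_mul.
    by rewrite (proj1 S1p) (proj1 S2p).
  rewrite !expand addrACA -mulmxDl -mulmxDr -SE [X in _ = X + _]addrACA.
  rewrite -opprD -mulmxDr -SG [X in _ = X - _ + _]addrACA -opprD -mulmxDl -GS.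
  by rewrite /congr_mx mulmxA subrK.
by apply: psdD; apply: psdZ; rewrite ?subr_ge0//; exact: psd_congr.
Qed.

Lemma stationary_pd (F S : 'M[R]_n) : spectral_radius F < 1 ->
  S = congr_mx F S + W -> pd S.
Proof.
move=> /spectral_radius_powers_vanish F0 SE.
have Sp : psd S.
  by apply: (lyapunov_psd F0); rewrite {1}SE addrAC subrr add0r; exact: pd_psd.
by rewrite SE; apply: psd_pdD => //; exact: psd_congr.
Qed.

(** The mixture [T] of the covariances only satisfies the Lyapunov inequality of the mixed gain.
    This already gives stability, and the true stationary covariance [S] lies below [T]; traces
    against psd matrices preserve that order. *)
Lemma stationary_convex (K1 K2 : 'M[R]_(m, n)) (S1 S2 : 'M[R]_n) (a : R) :
  0 <= a -> a <= 1 ->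
  spectral_radius (A - B *m K1) < 1 -> spectral_radius (A - B *m K2) < 1 ->
  S1 = congr_mx (A - B *m K1) S1 + W -> S2 = congr_mx (A - B *m K2) S2 + W ->
  exists K S, [/\ spectral_radius (A - B *m K) < 1,
    S = congr_mx (A - B *m K) S + W,
    forall M, psd M ->
      \tr (M *m S) <= a * \tr (M *m S1) + (1 - a) * \tr (M *m S2)
    & forall M, psd M -> \tr (M *m congr_mx K S) <=
        a * \tr (M *m congr_mx K1 S1) + (1 - a) * \tr (M *m congr_mx K2 S2)].
Proof.
move=> a0 a1 st1 st2 S1E S2E.
have S1pd := stationary_pd st1 S1E; have S2pd := stationary_pd st2 S2E.
have [S1p S2p] := (pd_psd S1pd, pd_psd S2pd).
pose T := a *: S1 + (1 - a) *: S2.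
have Tpsd : psd T by apply: psdD; apply: psdZ; rewrite ?subr_ge0.
have Tpd : pd T.
  have WE : T = (a *: congr_mx (A - B *m K1) S1
      + (1 - a) *: congr_mx (A - B *m K2) S2) + W.
    rewrite /T {1}S1E {1}S2E !scalerDr addrACA -scalerDl.
    by rewrite [a + _]addrC subrK scale1r.
  rewrite WE; apply: psd_pdD => //.
  by apply: psdD; apply: psdZ; rewrite ?subr_ge0//; exact: psd_congr.
pose K := (a *: (K1 *m S1) + (1 - a) *: (K2 *m S2)) *m invmx T.
have KT : K *m T = a *: (K1 *m S1) + (1 - a) *: (K2 *m S2).
  by rewrite mulmxKV// pd_unitmx.
(* The closed-loop matrix is affine in the gain, so it inherits the weighted-mean relation from
   [KT]. *)
have FT : (A - B *m K) *m T = a *: ((A - B *m K1) *m S1)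
    + (1 - a) *: ((A - B *m K2) *m S2).
  rewrite mulmxBl -mulmxA KT /T !mulmxDr !mulmxBl -!scalemxAr !mulmxA.
  by rewrite !scalerBr addrACA opprD.
have gapF := weighted_congr a0 a1 S1p S2p (proj1 Tpsd) erefl FT.
have gapK := weighted_congr a0 a1 S1p S2p (proj1 Tpsd) erefl KT.
have TF : T - congr_mx (A - B *m K) T = (a *: congr_mx (A - B *m K1) S1
      + (1 - a) *: congr_mx (A - B *m K2) S2 - congr_mx (A - B *m K) T) + W.
  rewrite {1}/T {1}S1E {1}S2E !scalerDr addrACA -scalerDl.
  by rewrite [a + _]addrC subrK scale1r [LHS]addrAC.
have st : spectral_radius (A - B *m K) < 1.
  by apply: (lyapunov_stable Tpd); rewrite TF; exact: psd_pdD.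
have F0 := spectral_radius_powers_vanish st.
have [S SE] := lyapunov_exists W F0.
(* [T - S] has the psd matrix of [gapF] as its Lyapunov residual, the two copies of [W]
   cancelling. *)
have TS : psd (T - S).
  have SW : S - congr_mx (A - B *m K) S = W by rewrite {1}SE addrAC subrr add0r.
  apply: (lyapunov_psd F0).
  by rewrite congr_mxB opprD addrACA -opprD TF SW addrK.
have TE : a *: S1 + (1 - a) *: S2 = T by [].
clearbody K T; exists K, S; split => // M Mp.
- rewrite -!mxtraceZ -mxtraceD !scalemxAr -mulmxDr TE -subr_ge0 -linearB /=.
  by rewrite -mulmxBr; exact: mxtrace_psd_ge0.
(* Two comparisons: [S] is replaced by [T] under the gain [K], then [gapK] splits the control
   covariance of [T]. *)
- have h1 : 0 <= \tr (M *m congr_mx K T - M *m congr_mx K S).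
    by rewrite -mulmxBr -congr_mxB; apply: mxtrace_psd_ge0 => //; exact: psd_congr.
  have h2 := mxtrace_psd_ge0 Mp gapK.
  rewrite raddfB /= subr_ge0 in h1; apply: le_trans h1 _.
  move: h2; rewrite mulmxBr raddfB /= subr_ge0 mulmxDr -!scalemxAr.
  by rewrite mxtraceD !mxtraceZ.
Qed.

End Convexity.

(** * Expectations *)

Section SquareIntegrable.
Context {R : realType} {d : measure_display} {T : measurableType d}.
Variable P : probability T R.
Local Notation L1 := (Lfun P 1).
Local Notation L2 := (Lfun P 2%:E).
Local Notation EE X := (fine (expectation P X%R)).

Lemma Lfun2_sqr_lty (f : T -> R) : measurable_fun setT f ->
  ('E_P[fun x => (f x ^+ 2)%R] < +oo)%E -> f \in L2.
Proof.
move=> mf; rewrite unlock => foo.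
rewrite inE/=; apply/andP; split; rewrite inE//=.
rewrite /finite_norm unlock /Lnorm poweR_lty//.
apply: le_lt_trans foo; rewrite le_eqVlt; apply/orP; left; apply/eqP.
by apply: eq_integral => x _; rewrite /= powR_mulrn// -normrX ger0_norm// sqr_ge0.
Qed.

Lemma Lfun2_sqr_le (f : T -> R) (g : T -> R) :
  measurable_fun setT f -> measurable_fun setT g ->
  (forall x, f x ^+ 2 <= g x) -> ('E_P[g] < +oo)%E -> f \in L2.
Proof.
move=> mf mg fg goo; apply: Lfun2_sqr_lty => //; apply: le_lt_trans goo.
apply: expectation_le => //.
- exact: measurable_funX.
- by move=> x; exact: sqr_ge0.
- by move=> x; apply: le_trans (fg x); exact: sqr_ge0.
- exact: aeW.
Qed.

Lemma Lfun21 (f : T -> R) : f \in L2 -> f \in L1.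
Proof. exact: (Lfun_subset12 (fin_num_measure P _ measurableT)). Qed.

Lemma Lfun2_mul (f g : T -> R) : f \in L2 -> g \in L2 ->
  (fun x => f x * g x) \in L1.
Proof. exact: Lfun2_mul_Lfun1. Qed.

Lemma Lfun_sum (p : R) (p1 : (1 <= p%:E)%E) (I : Type) (s : seq I)
    (c : I -> R) (f : I -> T -> R) :
  (forall i, f i \in Lfun P p%:E) ->
  (fun x => \sum_(i <- s) c i * f i x) \in Lfun P p%:E.
Proof.
move=> fL; elim: s => [|i s IH].
  under eq_fun do rewrite big_nil; exact: Lfun_cst.
under eq_fun do rewrite big_cons.
apply: (@rpredD _ (Lfun P p%:E)) => //.
rewrite (_ : (fun x => _) = c i \o* f i); first exact: Lfun_scale.
by apply/funext => x /=; rewrite mulrC.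
Qed.

Lemma EED (f g : T -> R) : f \in L1 -> g \in L1 ->
  EE (fun x => f x + g x) = EE f + EE g.
Proof.
move=> fL gL; rewrite -fineD ?expectation_fin_num//.
by rewrite -expectationD.
Qed.

Lemma EEZ (c : R) (f : T -> R) : f \in L1 -> EE (fun x => c * f x) = c * EE f.
Proof.
move=> fL; rewrite (_ : (fun x => _) = c \o* f).
  by rewrite expectationZl// fineM ?expectation_fin_num.
by apply/funext => x /=; rewrite mulrC.
Qed.

Lemma EE_cst (c : R) : EE (fun=> c) = c.
Proof. by rewrite expectation_cst. Qed.

Lemma EE_sum (I : Type) (s : seq I) (c : I -> R) (f : I -> T -> R) :
  (forall i, f i \in L1) ->
  EE (fun x => \sum_(i <- s) c i * f i x) = \sum_(i <- s) c i * EE (f i).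
Proof.
move=> fL; elim: s => [|i s IH].
  by under eq_fun do rewrite big_nil; rewrite big_nil EE_cst.
under eq_fun do rewrite big_cons; rewrite big_cons EED ?EEZ ?IH//.
  rewrite (_ : (fun x => _) = c i \o* f i); first exact: Lfun_scale.
  by apply/funext => x /=; rewrite mulrC.
exact: Lfun_sum.
Qed.

Lemma EE_le (f g : T -> R) : f \in L1 -> g \in L1 -> (forall x, f x <= g x) ->
  EE f <= EE g.
Proof.
move=> fL gL fg; rewrite fine_le ?expectation_fin_num// unlock.
apply: le_integral => //; [exact/Lfun1_integrable|exact/Lfun1_integrable|].
by move=> x _; rewrite lee_fin.
Qed.

(** Integrated from [|f g| <= f^2 + g^2], which suffices for boundedness uniform in time. *)
Lemma EE_mul_bound (f g : T -> R) : f \in L2 -> g \in L2 ->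
  `|EE (fun x => f x * g x)| <= EE (fun x => f x * f x) + EE (fun x => g x * g x).
Proof.
move=> fL gL.
have [ff gg fg] := And3 (Lfun2_mul fL fL) (Lfun2_mul gL gL) (Lfun2_mul fL gL).
rewrite -EED// ler_norml; apply/andP; split.
  rewrite lerNl -mulN1r -EEZ//; apply: EE_le => //.
  - by rewrite (_ : (fun x => _) = (-1) \o* (fun x => f x * g x)) ?Lfun_scale//;
      apply/funext => x /=; rewrite mulrC.
  - exact: (@rpredD _ (Lfun P 1)).
  - by move=> x; nra.
apply: EE_le => //; first exact: (@rpredD _ (Lfun P 1)).
by move=> x; nra.
Qed.

(** Independence says that the joint law of [(X, Y)] agrees with the product of the marginals on
    rectangles, hence everywhere; Fubini then factors the integral of the product. *)
Lemma independent_EE_mul (X Y : {mfun T >-> R}) :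
  (forall A B, measurable A -> measurable B ->
    P (X @^-1` A `&` Y @^-1` B) = (P (X @^-1` A) * P (Y @^-1` B))%E) ->
  (X : T -> R) \in L1 -> (Y : T -> R) \in L1 -> (fun x => X x * Y x) \in L1 ->
  EE (fun x => X x * Y x) = EE X * EE Y.
Proof.
move=> indep XL YL XYL.
pose Z x := (X x, Y x).
have mZ : measurable_fun setT Z by exact: measurable_fun_pair.
pose Zm : {mfun T >-> (R * R)%type} := mfun_Sub (mem_set mZ).
have prodE : forall C, measurable C ->
    (distribution P X \x distribution P Y)%E C = distribution P Zm C.
  apply: product_measure_unique => A B mA mB; exact: indep.
have mg : measurable_fun setT (fun z : R * R => z.1 * z.2).
  exact: measurable_funM.
pose f := EFin \o (fun z : R * R => z.1 * z.2).
have mf : measurable_fun setT f by exact/measurable_EFinP.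
have fZ : P.-integrable setT (f \o Zm) by exact/Lfun1_integrable.
have If : (\int[distribution P X \x distribution P Y]_z f z = 'E_P[fun x => (X x * Y x)%R])%E.
  rewrite (@eq_measure_integral _ _ _ _ (distribution P Zm)); last first.
    by move=> C mC _; exact: prodE.
  by rewrite integral_pushforward// unlock.
(* Fubini needs integrability under the product law; it is carried over from [P] along [Zm]. *)
have If2 : (distribution P X \x distribution P Y)%E.-integrable setT f.
  apply/integrableP; split => //.
  rewrite (@eq_measure_integral _ _ _ _ (distribution P Zm)); last first.
    by move=> C mC _; exact: prodE.
  by have /integrableP[] := @integrable_pushforward _ _ _ _ _ _ mZ P setT f mf fZ measurableT.
have mE : measurable_fun [set: R] (@EFin R) by exact: EFin_measurable.
have push (V : {mfun T >-> R}) : (V : T -> R) \in L1 ->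
    (distribution P V).-integrable setT (@EFin R) /\
    (\int[distribution P V]_x x%:E = expectation P V)%E.
  move=> /Lfun1_integrable VL; split.
    by apply: integrable_pushforward => //; exact: measurable_funP.
  rewrite integral_pushforward ?[in RHS]unlock// preimage_setT.
have [[iX IX] [iY IY]] := (push _ XL, push _ YL).
rewrite -If -(integral12_prod_meas1 If2).
have -> : (\int[distribution P X]_x \int[distribution P Y]_y f (x, y) =
    \int[distribution P X]_x (x%:E * expectation P Y))%E.
  by apply: eq_integral => x _; rewrite -IY -integralZl.
rewrite -(fineK (expectation_fin_num YL)) integralZr// IX.
by rewrite fineM ?expectation_fin_num// fineK ?expectation_fin_num.
Qed.

End SquareIntegrable.

(** * Continuous functions of random vectors *)

Section RandomVectorTheory.
Context {R : realType} {d : measure_display} {T : measurableType d}.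
Variable P : probability T R.
Local Notation EE X := (fine (expectation P X%R)).

Lemma continuous_borel n (g : 'cV[R]_n -> R) (A : set R) :
  continuous g -> measurable A -> borel (g @^-1` A).
Proof.
move=> gc mA.
have mg : @measurable_fun _ _ (g_sigma_algebraType [set U : set 'cV[R]_n | open U]) R
    setT g.
  apply: (measurability _ (RGenOInfty.measurableE R)) => _ [_ [x ->] <-].
  rewrite setTI; apply: sub_sigma_algebra => /=.
  by apply: open_comp => //; exact: open_gt.
by have := mg measurableT A mA; rewrite setTI.
Qed.

Lemma random_vector_comp n (Y : T -> 'cV[R]_n) (g : 'cV[R]_n -> R) :
  random_vector Y -> continuous g -> measurable_fun setT (fun x => g (Y x)).
Proof.
by move=> Yr gc _ A mA; rewrite setTI; apply: (Yr _ (continuous_borel gc mA)).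
Qed.

Lemma identically_distributed_EE n (w : nat -> T -> 'cV[R]_n)
    (g : 'cV[R]_n -> R) (s t : nat) :
  (forall t, random_vector (w t)) -> identically_distributed P w ->
  continuous g -> (fun x => g (w s x)) \in Lfun P 1 ->
  (fun x => g (w t x)) \in Lfun P 1 ->
  EE (fun x => g (w s x)) = EE (fun x => g (w t x)).
Proof.
move=> wr wid gc sL tL.
pose X u : {mfun T >-> R} := mfun_Sub (mem_set (random_vector_comp (wr u) gc)).
have push u : (fun x => g (w u x)) \in Lfun P 1 ->
    (\int[distribution P (X u)]_y y%:E =
      expectation P (fun x => g (w u x)))%E.
  move=> /Lfun1_integrable uL.
  by rewrite integral_pushforward ?[in RHS]unlock// ?preimage_setT.
rewrite -(push s sL) -(push t tL); congr fine.
apply: eq_measure_integral => A mA _.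
exact: (wid s t _ (continuous_borel gc mA)).
Qed.

Lemma independent_seq_EE n (w : nat -> T -> 'cV[R]_n)
    (g h : 'cV[R]_n -> R) (s t : nat) :
  (forall t, random_vector (w t)) -> independent_seq P w -> s != t ->
  continuous g -> continuous h ->
  (fun x => g (w s x)) \in Lfun P 2%:E -> (fun x => h (w t x)) \in Lfun P 2%:E ->
  EE (fun x => g (w s x) * h (w t x)) =
    EE (fun x => g (w s x)) * EE (fun x => h (w t x)).
Proof.
move=> wr wi st gc hc gL hL.
have mX := random_vector_comp (wr s) gc.
have mY := random_vector_comp (wr t) hc.
pose X : {mfun T >-> R} := mfun_Sub (mem_set mX).
pose Y : {mfun T >-> R} := mfun_Sub (mem_set mY).
apply: (@independent_EE_mul _ _ _ P X Y).
- move=> A B mA mB.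
  (* The independence condition takes a family indexed by all times; only its values at [s] and [t]
     matter. *)
  pose E u := if u == s then g @^-1` A else h @^-1` B.
  have := wi [:: s; t] E; rewrite /= inE st !big_cons big_nil mule1.
  rewrite /E eqxx eq_sym (negbTE st) => <-//.
    congr (P _); rewrite eqEsubset; split=> x.
      move=> [/= xA xB] u /=; rewrite !inE => /orP[/eqP->|/eqP->].
        by rewrite eqxx.
      by rewrite eq_sym (negbTE st).
    move=> H; split; first by have := H s; rewrite /= !inE eqxx; apply.
    have := H t; rewrite /= !inE eqxx orbT eq_sym (negbTE st); apply => //.
  by move=> u; case: ifP => _; exact: continuous_borel.
- exact: Lfun21.
- exact: Lfun21.
- exact: Lfun2_mul.
Qed.

End RandomVectorTheory.

(** * Integrability and expectation of random matrices *)

Section MatrixExpectation.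
Context {R : realType} {d : measure_display} {T : measurableType d}.
Variable P : probability T R.
Local Notation EE X := (fine (expectation P X%R)).

Definition mxLfun (r : R) p q (Y : T -> 'M[R]_(p, q)) :=
  forall i j, (fun x => Y x i j) \in Lfun P r%:E.

Lemma mxLfun_cst r p q (M : 'M[R]_(p, q)) : mxLfun r (fun=> M).
Proof. by move=> i j; exact: Lfun_cst. Qed.

Lemma mxLfunD r (r1 : (1 <= r%:E)%E) p q (X Y : T -> 'M[R]_(p, q)) :
  mxLfun r X -> mxLfun r Y -> mxLfun r (fun x => X x + Y x).
Proof.
move=> XL YL i j; under eq_fun do rewrite mxE.
exact: (@rpredD _ (Lfun P r%:E)).
Qed.

Lemma mxLfun_tr r p q (Y : T -> 'M[R]_(p, q)) :
  mxLfun r Y -> mxLfun r (fun x => (Y x)^T).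
Proof. by move=> YL i j; under eq_fun do rewrite mxE; exact: YL. Qed.

Lemma mxLfun_mull r (r1 : (1 <= r%:E)%E) p q s (M : 'M[R]_(p, q))
    (Y : T -> 'M[R]_(q, s)) :
  mxLfun r Y -> mxLfun r (fun x => M *m Y x).
Proof.
move=> YL i j; under eq_fun do rewrite mxE.
by apply: Lfun_sum => // k; exact: YL.
Qed.

Lemma mxLfun_mulr r (r1 : (1 <= r%:E)%E) p q s (M : 'M[R]_(q, s))
    (Y : T -> 'M[R]_(p, q)) :
  mxLfun r Y -> mxLfun r (fun x => Y x *m M).
Proof.
move=> YL; have := mxLfun_tr (mxLfun_mull r1 M^T (mxLfun_tr YL)).
by under eq_fun do rewrite trmx_mul !trmxK.
Qed.

Lemma mxLfun21 p q (Y : T -> 'M[R]_(p, q)) : mxLfun 2 Y -> mxLfun 1 Y.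
Proof. by move=> YL i j; exact: Lfun21. Qed.

Lemma mxLfun2_outer p q (X : T -> 'cV[R]_p) (Y : T -> 'cV[R]_q) :
  mxLfun 2 X -> mxLfun 2 Y -> mxLfun 1 (fun x => X x *m (Y x)^T).
Proof.
move=> XL YL i j; under eq_fun do rewrite mxE big_ord1 mxE.
exact: Lfun2_mul.
Qed.

Lemma Emx_cst p q (M : 'M[R]_(p, q)) : Emx P (fun=> M) = M.
Proof. by apply/matrixP => i j; rewrite mxE EE_cst. Qed.

Lemma EmxD p q (X Y : T -> 'M[R]_(p, q)) : mxLfun 1 X -> mxLfun 1 Y ->
  Emx P (fun x => X x + Y x) = Emx P X + Emx P Y.
Proof.
move=> XL YL; apply/matrixP => i j; rewrite !mxE -EED//.
by under eq_fun do rewrite mxE.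
Qed.

Lemma Emx_tr p q (Y : T -> 'M[R]_(p, q)) : Emx P (fun x => (Y x)^T) = (Emx P Y)^T.
Proof. by apply/matrixP => i j; rewrite !mxE; under eq_fun do rewrite mxE. Qed.

Lemma Emx_mull p q s (M : 'M[R]_(p, q)) (Y : T -> 'M[R]_(q, s)) :
  mxLfun 1 Y -> Emx P (fun x => M *m Y x) = M *m Emx P Y.
Proof.
move=> YL; apply/matrixP => i j; rewrite !mxE.
under eq_fun do rewrite mxE.
rewrite EE_sum//; first by apply: eq_bigr => k _; rewrite mxE.
Qed.

Lemma Emx_mulr p q s (M : 'M[R]_(q, s)) (Y : T -> 'M[R]_(p, q)) :
  mxLfun 1 Y -> Emx P (fun x => Y x *m M) = Emx P Y *m M.
Proof.
move=> YL; rewrite -[RHS]trmxK trmx_mul -Emx_tr -Emx_mull; last exact: mxLfun_tr.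
by rewrite -Emx_tr; under [in RHS]eq_fun do rewrite trmx_mul !trmxK.
Qed.

Lemma Emx_trace p (Y : T -> 'M[R]_p) : mxLfun 1 Y ->
  (fun x => \tr (Y x)) \in Lfun P 1 /\ EE (fun x => \tr (Y x)) = \tr (Emx P Y).
Proof.
move=> YL.
have E : (fun x => \tr (Y x)) = (fun x => \sum_i 1 * Y x i i).
  by apply/funext => x; apply: eq_bigr => i _; rewrite mul1r.
rewrite E; split; first by apply: Lfun_sum => // i; exact: YL.
rewrite EE_sum; last by move=> i; exact: YL.
by apply: eq_bigr => i _; rewrite mul1r mxE.
Qed.

Lemma Emx_outer_bound p q (X : T -> 'cV[R]_p) (Y : T -> 'cV[R]_q) i j :
  mxLfun 2 X -> mxLfun 2 Y ->
  `|Emx P (fun x => X x *m (Y x)^T) i j| <=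
    Emx P (fun x => X x *m (X x)^T) i i + Emx P (fun x => Y x *m (Y x)^T) j j.
Proof.
move=> XL YL; rewrite !mxE.
under eq_fun do rewrite mxE big_ord1 mxE.
under [X in _ <= EE X + _]eq_fun do rewrite mxE big_ord1 mxE.
under [X in _ <= _ + EE X]eq_fun do rewrite mxE big_ord1 mxE.
exact: EE_mul_bound.
Qed.

(** With [q] the squared Euclidean norm, each squared coordinate is at most [q], and
    [q <= 1 + q ^+ k]. The cases [k = 1] and [k = 2] serve the initial state and the noise. *)
Lemma finite_even_moment_mxLfun n (k : nat) (Y : T -> 'cV[R]_n) : (0 < k)%N ->
  random_vector Y -> finite_even_moment P k Y -> mxLfun 2 Y.
Proof.
move=> k0 Yr Yk i j; rewrite ord1.
have coordc l : continuous (fun v : 'cV[R]_n => v l 0) by exact: coord_continuous.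
have qE (v : 'cV[R]_n) : qform 1%:M v = \sum_l v l 0 * v l 0.
  by rewrite /qform mulmx1 mxE; apply: eq_bigr => l _; rewrite mxE.
have sc (s : seq 'I_n) :
    continuous (fun v : 'cV[R]_n => \sum_(l <- s) v l 0 * v l 0).
  elim: s => [|l s IH] v.
    rewrite (_ : (fun v => _) = cst 0); first exact: cst_continuous.
    by apply/funext => u; rewrite big_nil.
  rewrite (_ : (fun v => _) = (fun v : 'cV[R]_n =>
    v l 0 * v l 0 + \sum_(l <- s) v l 0 * v l 0)).
    have h1 : (fun u : 'cV[R]_n => u l 0 * u l 0) @ v --> v l 0 * v l 0.
      by have h2 := coordc l v; exact: (cvgM h2 h2).
    exact: (cvgD h1 (IH v)).
  by apply/funext => u; rewrite big_cons.
have qc : continuous (fun v : 'cV[R]_n => qform 1%:M v ^+ k).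
  rewrite (_ : (fun v => _) = (fun v : 'cV[R]_n => (\sum_l v l 0 * v l 0) ^+ k)); last first.
    by apply/funext => v; rewrite qE.
  by move=> v; apply: (@continuous_comp _ _ _ (fun v : 'cV[R]_n =>
    \sum_l v l 0 * v l 0) (fun x => x ^+ k)); [exact: sc|exact: exprn_continuous].
have mq := random_vector_comp Yr qc.
apply: (@Lfun2_sqr_le _ _ _ P _ (fun x => 1 + qform 1%:M (Y x) ^+ k)).
- exact: (random_vector_comp Yr (coordc i)).
- exact: measurable_funD.
- move=> x; rewrite qE; set S := \sum_l _.
  have YS : Y x i 0 ^+ 2 <= S.
    rewrite /S (bigD1 i)//= -expr2 lerDl; apply: sumr_ge0 => l _.
    by rewrite -expr2 sqr_ge0.
  apply: le_trans YS _; have S0 : 0 <= S.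
    by apply: sumr_ge0 => l _; rewrite -expr2 sqr_ge0.
  have [S1|S1] := leP S 1; first by rewrite ler_wpDr// exprn_ge0.
  by rewrite ler_wpDl// -[X in X <= _]expr1 ler_weXn2l// ltW.
- have q0 x : 0 <= qform 1%:M (Y x) ^+ k.
    rewrite exprn_ge0// qE; apply: sumr_ge0 => l _; by rewrite -expr2 sqr_ge0.
  have qL : (fun x => qform 1%:M (Y x) ^+ k) \in Lfun P 1.
    apply/Lfun1_integrable/integrableP; split; first exact/measurable_EFinP.
    apply: le_lt_trans Yk; rewrite unlock le_eqVlt; apply/orP; left; apply/eqP.
    by apply: eq_integral => x _; rewrite /= ger0_norm.
  have := @expectationD _ _ _ P (cst 1) (fun x => qform 1%:M (Y x) ^+ k).
  move=> ->//; last exact: Lfun_cst.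
  by rewrite expectation_cst -(fineK (expectation_fin_num qL)) -EFinD ltry.
Qed.

End MatrixExpectation.

(** * Stationary moments and average costs *)

Section NoiseResponse.
Context {R : realType} {d : measure_display} {T : measurableType d}.
Variable P : probability T R.
Variables (n : nat) (w : nat -> T -> 'cV[R]_n).
Hypothesis w_iid : iid P w.
Hypothesis w_L2 : forall t, mxLfun P 2 (w t).

Local Notation wbar := (Emx P (w 0%N)).
Local Notation W := (covmx P (w 0%N)).

(** The mean of [w 0] is subtracted at every time, which keeps the drift constant; identical
    distribution makes it the mean of each [w t]. *)
Definition deviation t x : 'cV[R]_n := w t x - wbar.

Let le12 : (1 <= 2%:E :> \bar R)%E. Proof. by rewrite lee_fin; lra. Qed.

Lemma deviation_L2 t : mxLfun P 2 (deviation t).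
Proof. by apply: mxLfunD => //; exact: (mxLfun_cst _ _ (- wbar)). Qed.

(** Writes coordinates of the deviation as continuous functions of the noise, the form to which
    independence and equality in law apply. *)
Let dev_coord (i : 'I_n) := fun u : 'cV[R]_n => u i 0 - wbar i 0.

Let dev_coord_continuous i : continuous (dev_coord i).
Proof.
move=> u; have h := @coord_continuous R n 1 i 0 u.
exact: (cvgB h (cvg_cst (wbar i 0))).
Qed.

Let deviationE t x i : deviation t x i 0 = dev_coord i (w t x).
Proof. by rewrite /dev_coord !mxE. Qed.

Lemma Emx_noise t : Emx P (w t) = wbar.
Proof.
have [wr _ wid] := w_iid.
apply/matrixP => i j; rewrite !mxE ord1.
apply: (@identically_distributed_EE _ _ _ P _ w (fun u => u i 0)) => //.
- exact: coord_continuous.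
- exact/Lfun21/w_L2.
- exact/Lfun21/w_L2.
Qed.

Lemma Emx_deviation t : Emx P (deviation t) = 0.
Proof.
rewrite EmxD; first by rewrite Emx_noise Emx_cst subrr.
  exact/mxLfun21/w_L2.
exact: (mxLfun_cst _ _ (- wbar)).
Qed.

Lemma Emx_deviation_same t :
  Emx P (fun x => deviation t x *m (deviation t x)^T) = W.
Proof.
have [wr _ wid] := w_iid.
have E s i j : (fun x => (deviation s x *m (deviation s x)^T) i j) =
    (fun x => dev_coord i (w s x) * dev_coord j (w s x)).
  by apply/funext => x; rewrite mxE big_ord1 [_^T _ _]mxE !deviationE.
have L s i j : (fun x => dev_coord i (w s x) * dev_coord j (w s x)) \in Lfun P 1.
  by rewrite -E; exact: (mxLfun2_outer (deviation_L2 s) (deviation_L2 s)).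
apply/matrixP => i j; rewrite [LHS]mxE [RHS]mxE.
rewrite E -[X in _ = fine (expectation P X)]/(fun x =>
  (deviation 0%N x *m (deviation 0%N x)^T) i j) E.
apply: (@identically_distributed_EE _ _ _ P _ w
  (fun u => dev_coord i u * dev_coord j u)) => // u.
have hi := @dev_coord_continuous i u; have hj := @dev_coord_continuous j u.
exact: (cvgM hi hj).
Qed.

Lemma Emx_deviation_cross s t : s != t ->
  Emx P (fun x => deviation s x *m (deviation t x)^T) = 0.
Proof.
move=> st; have [wr wi _] := w_iid.
apply/matrixP => i j; rewrite [LHS]mxE [RHS]mxE.
rewrite (_ : (fun x => _) = (fun x => dev_coord i (w s x) * dev_coord j (w t x))); last first.
  by apply/funext => x; rewrite mxE big_ord1 [_^T _ _]mxE !deviationE.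
have dL u k : (fun x => dev_coord k (w u x)) \in Lfun P 2%:E.
  have := deviation_L2 u k 0; by under eq_fun do rewrite deviationE.
rewrite (independent_seq_EE wr wi st)//.
have := congr1 (fun M : 'cV[R]_n => M i 0) (Emx_deviation s).
rewrite /= !mxE; under eq_fun do rewrite deviationE.
by move=> ->; rewrite mul0r.
Qed.

Variable F : 'M[R]_n.

(** The centered state started from 0. It is separated from the contribution of the initial state,
    which may be correlated with the noise. *)
Fixpoint noise_response t x : 'cV[R]_n :=
  if t is t'.+1 then F *m noise_response t' x + deviation t' x else 0.

Lemma noise_response_L2 t : mxLfun P 2 (noise_response t).
Proof.
elim: t => [|t IH]; first exact: mxLfun_cst.
by apply: mxLfunD => //; [exact: mxLfun_mull|exact: deviation_L2].
Qed.

Lemma Emx_noise_response t : Emx P (noise_response t) = 0.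
Proof.
elim: t => [|t IH]; first exact: Emx_cst.
have bL := mxLfun21 (noise_response_L2 t).
rewrite EmxD ?Emx_mull// ?IH ?mulmx0 ?add0r ?Emx_deviation//.
  exact: mxLfun_mull.
exact/mxLfun21/deviation_L2.
Qed.

(** The response at time [t] involves only deviations before [t], each uncorrelated with the one at
    [s]. *)
Lemma noise_response_uncorrelated t s : (t <= s)%N ->
  Emx P (fun x => noise_response t x *m (deviation s x)^T) = 0.
Proof.
elim: t => [|t IH] ts.
  by under eq_fun do rewrite mul0mx; exact: Emx_cst.
under eq_fun do rewrite mulmxDl -mulmxA.
have bL := mxLfun2_outer (noise_response_L2 t) (deviation_L2 s).
rewrite EmxD ?Emx_mull ?IH ?mulmx0 ?add0r//; last 3 first.
- exact: ltnW.
- exact: mxLfun_mull.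
- exact: (mxLfun2_outer (deviation_L2 t) (deviation_L2 s)).
by apply: Emx_deviation_cross; rewrite neq_ltn ts.
Qed.

Variable S : 'M[R]_n.
Hypothesis S_stationary : S = congr_mx F S + W.

(** The stationary equation telescopes the sum of the [congr_mx (F ^+ k) W] into a closed form whose
    limit is immediate. *)
Lemma Emx_noise_response_sqr t :
  Emx P (fun x => noise_response t x *m (noise_response t x)^T) =
    S - congr_mx (F ^+ t) S.
Proof.
elim: t => [|t IH].
  rewrite expr0 /congr_mx trmx1 mulmx1 mul1mx subrr.
  by under eq_fun do rewrite mul0mx; exact: Emx_cst.
pose b := noise_response t; pose v := deviation t.
have bL : mxLfun P 2 b := noise_response_L2 t.
have vL : mxLfun P 2 v := deviation_L2 t.
rewrite (_ : (fun x => _) = (fun x => (congr_mx F (b x *m (b x)^T)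
    + v x *m (v x)^T) + (F *m (b x *m (v x)^T) + (F *m (b x *m (v x)^T))^T))); last first.
  apply/funext => x /=; rewrite [(_ + _)^T]linearD /= !trmx_mul trmxK.
  rewrite mulmxDl !mulmxDr /congr_mx !mulmxA.
  by rewrite [X in _ + X = _]addrC addrACA.
have bbL := mxLfun2_outer bL bL; have vvL := mxLfun2_outer vL vL.
have FbvL := mxLfun_mull (lexx _) F (mxLfun2_outer bL vL).
rewrite EmxD; last 2 first.
- by apply: mxLfunD => //; apply: mxLfun_mulr => //; exact: mxLfun_mull.
- by apply: mxLfunD => //; exact: mxLfun_tr.
rewrite EmxD//; last by apply: mxLfun_mulr => //; exact: mxLfun_mull.
rewrite EmxD//; last exact: mxLfun_tr.
rewrite Emx_tr Emx_mull; last exact: mxLfun2_outer.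
rewrite noise_response_uncorrelated// mulmx0 trmx0 !addr0.
rewrite Emx_deviation_same Emx_mulr; last exact: mxLfun_mull.
rewrite Emx_mull// IH -/(congr_mx F _) congr_mxB congr_mxA mulmxE -exprS.
by rewrite addrAC -S_stationary.
Qed.

End NoiseResponse.

(** * Long-run averages of convergent expected costs *)

Section AverageCost.
Context {R : realType} {d : measure_display} {T : measurableType d}.
Variable P : probability T R.
Local Notation EE X := (fine (expectation P X%R)).

Lemma average_cost_cvg (c : nat -> T -> R) (l : R) :
  (forall t, c t \in Lfun P 1) -> (fun t => EE (c t)) @ \oo --> l ->
  average_cost P c = l%:E.
Proof.
move=> cL cl.
have cE k : 'E_P[fun om => (\sum_(t < k) c t om)%R]%E = (\sum_(t < k) EE (c t))%:E.
  have E : (fun om => \sum_(t < k) c t om) = (fun om => \sum_(t < k) 1 * c t om).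
    by apply/funext => x; apply: eq_bigr => t _; rewrite mul1r.
  rewrite E -[LHS]fineK ?expectation_fin_num ?Lfun_sum//.
  by rewrite EE_sum//; congr (_%:E); apply: eq_bigr => t _; rewrite mul1r.
(* The shift drops the horizon 0 and matches [arithmetic_mean], which averages the first [k.+1]
   terms; Cesaro's theorem then applies. *)
apply/cvg_lim => //; rewrite -cvg_shiftS.
rewrite (_ : [sequence _]_k = EFin \o arithmetic_mean (fun t => EE (c t))).
  by apply: cvg_EFin; [exact: nearW|exact: cesaro].
by apply/funext => k; rewrite /= cE -EFinM /arithmetic_mean /series/= big_mkord.
Qed.

End AverageCost.

(** * First and second moments of the state around its equilibrium *)

Section StateMoments.
Context {R : realType} {d : measure_display} {T : measurableType d}.
Variable P : probability T R.
Variables (n m : nat) (A : 'M[R]_n) (B : 'M[R]_(n, m)).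
Variables (x0 : T -> 'cV[R]_n) (w : nat -> T -> 'cV[R]_n).
Hypothesis w_iid : iid P w.
Hypothesis w_L2 : forall t, mxLfun P 2 (w t).
Hypothesis x0_L2 : mxLfun P 2 x0.
Local Notation wbar := (Emx P (w 0%N)).
Local Notation W := (covmx P (w 0%N)).
Hypothesis W_psd : psd W.

Definition equilibrium (X : policy R n m) (xb : 'cV[R]_n) :=
  xb = A *m xb + B *m control X xb + wbar.

Variables (X : policy R n m) (xb : 'cV[R]_n) (S : 'M[R]_n).
Local Notation F := (A - B *m X.1).
Hypothesis F0 : powers_vanish F.
Hypothesis xb_eq : equilibrium X xb.
Hypothesis S_eq : S = congr_mx F S + W.

Let e0 x := x0 x - xb.
Definition error t x := F ^+ t *m e0 x + noise_response P w F t x.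

Let le12 : (1 <= 2%:E :> \bar R)%E. Proof. by rewrite lee_fin; lra. Qed.

Lemma controlD (y e : 'cV[R]_n) : control X (y + e) = control X y - X.1 *m e.
Proof. by rewrite /control mulmxDr opprD addrAC. Qed.

(** Subtracting the equilibrium equation removes the constant terms and leaves the linear recursion
    of [error] under [F], driven by [deviation]. *)
Lemma state_error t x : state A B x0 w X t x = xb + error t x.
Proof.
elim: t => [|t IH].
  by rewrite /error expr0 mul1mx addr0 /e0 addrC subrK.
have -> : error t.+1 x = F *m error t x + deviation P w t x.
  by rewrite /error exprS -mulmxE -mulmxA mulmxDr addrA.
rewrite /= IH controlD mulmxDr mulmxBr mulmxA mulmxBl /deviation.
rewrite [in RHS]xb_eq [RHS]addrACA [X in _ = _ + X]addrC subrK.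
by rewrite [X in _ = X + _]addrACA.
Qed.

Let e0_L2 : mxLfun P 2 e0.
Proof. by apply: mxLfunD => //; exact: (mxLfun_cst _ _ (- xb)). Qed.

Lemma error_L2 t : mxLfun P 2 (error t).
Proof.
by apply: mxLfunD => //; [exact: mxLfun_mull|exact: noise_response_L2].
Qed.

Lemma Emx_error_cvg : mx_cvg (fun t => Emx P (error t)) 0.
Proof.
have E t : Emx P (error t) = F ^+ t *m Emx P e0.
  rewrite EmxD; first by rewrite Emx_noise_response// addr0 Emx_mull//; exact: mxLfun21.
    by apply: mxLfun_mull => //; exact: mxLfun21.
  by apply: mxLfun21; exact: noise_response_L2.
under eq_fun do rewrite E.
by rewrite -(mul0mx _ (Emx P e0)); apply: mx_cvgM => //; exact: mx_cvg_cst.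
Qed.

(* The initial state may be correlated with the noise; the cross terms still
   vanish, being [F ^+ t] times a bounded matrix. *)
Lemma Emx_error_sqr_cvg :
  mx_cvg (fun t => Emx P (fun x => error t x *m (error t x)^T)) S.
Proof.
pose H t := Emx P (fun x => e0 x *m (noise_response P w F t x)^T).
pose S0 := Emx P (fun x => e0 x *m (e0 x)^T).
have E t : Emx P (fun x => error t x *m (error t x)^T) =
    congr_mx (F ^+ t) S0 + (S - congr_mx (F ^+ t) S)
    + (F ^+ t *m H t + (F ^+ t *m H t)^T).
  pose b := noise_response P w F t.
  have bL : mxLfun P 2 b by exact: noise_response_L2.
  rewrite (_ : (fun x => _) = (fun x => (congr_mx (F ^+ t) (e0 x *m (e0 x)^T)
    + b x *m (b x)^T) + (F ^+ t *m (e0 x *m (b x)^T)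
    + (F ^+ t *m (e0 x *m (b x)^T))^T))); last first.
    apply/funext => x /=; rewrite /error -/(b x); move: (e0 x) (b x) => y z.
    rewrite [(_ + _)^T]linearD /= !trmx_mul trmxK.
    rewrite mulmxDl !mulmxDr /congr_mx !mulmxA.
    by rewrite [X in _ + X = _]addrC addrACA.
  have eeL := mxLfun2_outer e0_L2 e0_L2; have bbL := mxLfun2_outer bL bL.
  have FebL := mxLfun_mull (lexx _) (F ^+ t) (mxLfun2_outer e0_L2 bL).
  have FeeL : mxLfun P 1 (fun x => congr_mx (F ^+ t) (e0 x *m (e0 x)^T)).
    by apply: mxLfun_mulr => //; exact: mxLfun_mull.
  rewrite EmxD; last 2 first.
  - exact: mxLfunD.
  - by apply: mxLfunD => //; exact: mxLfun_tr.
  rewrite EmxD// EmxD//; last exact: mxLfun_tr.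
  rewrite Emx_tr Emx_mull; last exact: mxLfun2_outer.
  rewrite Emx_mulr; last exact: mxLfun_mull.
  by rewrite Emx_mull// (Emx_noise_response_sqr w_iid w_L2 S_eq).
have S_psd : psd S.
  by apply: (lyapunov_psd F0); rewrite {1}S_eq addrAC subrr add0r.
(* A bound independent of time and entry: the diagonal of [S - congr_mx (F ^+ t) S] is at most that
   of [S], because the subtracted matrix is psd. *)
pose C := \sum_i `|S0 i i| + \sum_i `|S i i|.
have HC t i j : `|H t i j| <= C.
  apply: le_trans (Emx_outer_bound i j e0_L2 _) _.
    exact: noise_response_L2.
  rewrite (Emx_noise_response_sqr w_iid w_L2 S_eq) -/S0; apply: lerD.
    rewrite (bigD1 i)//=; apply: le_trans (ler_norm _) _.
    by rewrite lerDl; apply: sumr_ge0.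
  rewrite (bigD1 j)//=; apply: (@le_trans _ _ (S j j)).
    have -> : (S - congr_mx (F ^+ t) S) j j = S j j - congr_mx (F ^+ t) S j j.
      by rewrite !mxE.
    rewrite gerBl -qform_delta.
    exact: (proj2 (psd_congr _ S_psd)).
  apply: le_trans (ler_norm _) _.
  by rewrite lerDl; apply: sumr_ge0.
have FH := mx_cvg0_bounded F0 HC.
have lim : mx_cvg (fun t => congr_mx (F ^+ t) S0 + (S - congr_mx (F ^+ t) S)
    + (F ^+ t *m H t + (F ^+ t *m H t)^T)) (0 + (S - 0) + (0 + 0^T)).
  apply: mx_cvgD; last by apply: mx_cvgD => //; exact: mx_cvg_tr.
  apply: mx_cvgD; first exact: congr_powers_cvg0.
  by apply: mx_cvgD; [exact: mx_cvg_cst|apply: mx_cvgN; exact: congr_powers_cvg0].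
rewrite trmx0 !addr0 add0r subr0 in lim.
by move=> i j; under eq_fun do rewrite E; exact: lim.
Qed.

(** Both running costs have this shape. The linear term drops out because the mean error tends to 0,
    and the second moment of the error tends to [S]. *)
Lemma average_quadratic_cost (c : nat -> T -> R) (k : R) (N1 : 'M[R]_(1, n))
    (N2 : 'M[R]_n) :
  (forall t x, c t x = k + \tr (N1 *m error t x)
    + \tr (N2 *m (error t x *m (error t x)^T))) ->
  average_cost P c = (k + \tr (N2 *m S))%:E.
Proof.
move=> cE.
have eL t := mxLfun21 (error_L2 t).
have eeL t := mxLfun2_outer (error_L2 t) (error_L2 t).
have [L1 E1] := all_and2 (fun t => Emx_trace (mxLfun_mull (lexx _) N1 (eL t))).
have [L2 E2] := all_and2 (fun t => Emx_trace (mxLfun_mull (lexx _) N2 (eeL t))).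
have L01 t : (fun x => k + \tr (N1 *m error t x)) \in Lfun P 1.
  by apply: (@rpredD _ (Lfun P 1)) => //; exact: Lfun_cst.
have ctE t : c t = (fun x => k + \tr (N1 *m error t x)
    + \tr (N2 *m (error t x *m (error t x)^T))) by apply/funext => x.
apply: average_cost_cvg => [t|].
  by rewrite ctE; apply: (@rpredD _ (Lfun P 1)).
rewrite (_ : (fun t => _) = (fun t => k + \tr (N1 *m Emx P (error t))
    + \tr (N2 *m Emx P (fun x => error t x *m (error t x)^T)))); last first.
  apply/funext => t; rewrite ctE EED// EED//; last exact: Lfun_cst.
  by rewrite EE_cst E1 E2 !Emx_mull.
rewrite -[k in _ --> k + _]addr0; apply: cvgD; [apply: cvgD; first exact: cvg_cst|].
  rewrite -(mxtrace0 _ 1) -(mulmx0 _ N1); apply: mx_cvg_tr_trace.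
  by apply: mx_cvgM; [exact: mx_cvg_cst|exact: Emx_error_cvg].
apply: mx_cvg_tr_trace.
by apply: mx_cvgM; [exact: mx_cvg_cst|exact: Emx_error_sqr_cvg].
Qed.

End StateMoments.

(** Brings a quadratic cost to the shape of [average_quadratic_cost]; [G] is the identity for the
    state and minus the gain for the control. *)
Lemma qform_shift (R : realType) n p (M : 'M[R]_n) (G : 'M[R]_(n, p))
    (y : 'cV[R]_n) (e : 'cV[R]_p) :
  qform M (y + G *m e) = qform M y + \tr (y^T *m (M + M^T) *m G *m e)
    + \tr (G^T *m M *m G *m (e *m e^T)).
Proof.
have trE (N : 'M[R]_1) : N 0 0 = \tr N by rewrite trace_mx11.
rewrite /qform !trE [(_ + _)^T]linearD /= mulmxDl mulmxDl mxtraceD !mulmxDr.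
rewrite !mxtraceD -!addrA; congr (_ + _).
rewrite !mulmxDl !mxtraceD -addrA !mulmxA; congr (_ + (_ + _)).
  by rewrite -mxtrace_tr !trmx_mul !trmxK !mulmxA.
by rewrite [in RHS]mxtrace_mulC !mulmxA trmx_mul.
Qed.

(** * Average costs in terms of equilibrium and stationary covariance *)

Section CostFormulas.
Context {R : realType} {d : measure_display} {T : measurableType d}.
Variable P : probability T R.
Variables (n m : nat) (A : 'M[R]_n) (B : 'M[R]_(n, m)).
Variables (Q : 'M[R]_n) (Rc : 'M[R]_m).
Variables (x0 : T -> 'cV[R]_n) (w : nat -> T -> 'cV[R]_n).
Hypothesis w_iid : iid P w.
Hypothesis w_L2 : forall t, mxLfun P 2 (w t).
Hypothesis x0_L2 : mxLfun P 2 x0.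
Local Notation W := (covmx P (w 0%N)).
Hypothesis W_psd : psd W.
Variables (X : policy R n m) (xb : 'cV[R]_n) (S : 'M[R]_n).
Local Notation F := (A - B *m X.1).
Hypothesis F0 : powers_vanish F.
Hypothesis xb_eq : equilibrium P A B w X xb.
Hypothesis S_eq : S = congr_mx F S + W.

(** The matrix [congr_mx X.1 S] is the stationary covariance of the control. *)
Definition stationary_cost (X : policy R n m) xb S : R :=
  qform Q xb + qform Rc (control X xb) + \tr (Q *m S)
  + \tr (Rc *m congr_mx X.1 S).

Definition stationary_risk xb S : R :=
  4 * (qform (Q *m W *m Q) xb + (xb^T *m Q *m M3 P Q (w 0%N)) 0 0
    + \tr (Q *m W *m Q *m S)).

Lemma J_stationary : J P A B Q Rc x0 w X = (stationary_cost X xb S)%:E.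
Proof.
pose N1 := xb^T *m (Q + Q^T) + (control X xb)^T *m (Rc + Rc^T) *m - X.1.
pose N2 := Q + (- X.1)^T *m Rc *m - X.1.
rewrite /J (average_quadratic_cost w_iid w_L2 x0_L2 W_psd F0 S_eq
  (k := qform Q xb + qform Rc (control X xb)) (N1 := N1) (N2 := N2) (xb := xb)).
  congr (_%:E); rewrite /stationary_cost -[RHS]addrA; congr (_ + _).
  rewrite /N2 mulmxDl mxtraceD; congr (_ + _).
  rewrite -mulmxA -mulmxA mxtrace_mulC [_^T]linearN /= /congr_mx.
  by rewrite !(mulNmx, mulmxN) opprK !mulmxA.
move=> t x; rewrite (state_error x0 xb_eq); move: (error _ _ _ _ _ _ _ _ _) => e.
rewrite controlD -mulNmx -{1}[e]mul1mx !qform_shift trmx1 mul1mx !mulmx1.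
rewrite /N1 /N2 !mulmxDl !mxtraceD; lra.
Qed.

Lemma Jc_stationary : Jc P A B Q x0 w X = (stationary_risk xb S)%:E.
Proof.
pose M := Q *m W *m Q.
pose N1 := 4 *: (xb^T *m (M + M^T)) + 4 *: (Q *m M3 P Q (w 0%N))^T.
rewrite /Jc (average_quadratic_cost w_iid w_L2 x0_L2 W_psd F0 S_eq (N1 := N1)
  (k := 4 * qform M xb + 4 * (xb^T *m Q *m M3 P Q (w 0%N)) 0 0) (N2 := 4 *: M)
  (xb := xb)).
  congr (_%:E); rewrite /stationary_risk -scalemxAl mxtraceZ -/M.
  by rewrite !mulrDr.
move=> t x; rewrite (state_error x0 xb_eq); move: (error _ _ _ _ _ _ _ _ _) => e.
have lin : ((xb + e)^T *m Q *m M3 P Q (w 0%N)) 0 0 =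
    (xb^T *m Q *m M3 P Q (w 0%N)) 0 0 + \tr ((Q *m M3 P Q (w 0%N))^T *m e).
  rewrite [(_ + _)^T]linearD /= !mulmxDl -!trace_mx11 mxtraceD; congr (_ + _).
  by rewrite -[in LHS]mxtrace_tr !trmx_mul trmxK mulmxA.
rewrite -/M lin -{1}[e]mul1mx qform_shift trmx1 mul1mx !mulmx1.
rewrite /N1 mulmxDl mxtraceD -!scalemxAl !mxtraceZ; lra.
Qed.

End CostFormulas.

(** * Duality *)

(** An infeasible [X] demands [mu >= (p - f X) / (g X - c)], a strictly feasible [Y] demands
    [mu <= (f Y - p) / (c - g Y)]. Convexity puts every lower bound below every upper one, and the
    supremum of the lower bounds meets all demands. *)
Lemma lagrange_multiplier (R : realType) (T : Type) (S : set T) (f g : T -> R)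
    (p c : R) :
  (forall a X Y, 0 <= a -> a <= 1 -> S X -> S Y -> exists Z, [/\ S Z,
      f Z <= a * f X + (1 - a) * f Y & g Z <= a * g X + (1 - a) * g Y]) ->
  (exists2 X, S X & g X < c) ->
  (forall X, S X -> g X <= c -> p <= f X) ->
  exists2 mu, 0 <= mu & forall X, S X -> p <= f X + mu * (g X - c).
Proof.
move=> conv [X0 SX0 gX0] pmin.
have key X Y : S X -> S Y -> c < g X -> g Y < c ->
    (p - f X) / (g X - c) <= (f Y - p) / (c - g Y).
  move=> SX SY cX Yc.
  have dX : 0 < g X - c by rewrite subr_gt0.
  have dY : 0 < c - g Y by rewrite subr_gt0.
  have d0 : 0 < g X - g Y by rewrite subr_gt0 (lt_trans Yc).
  (* The weight for which the mixture of [g X] and [g Y] is exactly [c], so that [Z] is feasible. *)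
  pose a := (c - g Y) / (g X - g Y).
  have aE : a * (g X - g Y) = c - g Y by rewrite mulfVK ?gt_eqF.
  have a0 : 0 <= a by rewrite divr_ge0// ltW.
  have a1 : a <= 1 by rewrite ler_pdivrMr// mul1r lerD2r ltW.
  have [Z [SZ fZ gZ]] := conv a X Y a0 a1 SX SY.
  have {}gZ : g Z <= c by lra.
  have {fZ} pZ := le_trans (pmin _ SZ gZ) fZ.
  rewrite ler_pdivrMr// mulrAC ler_pdivlMr//.
  have -> : (f Y - p) * (g X - c) = (p - f X) * (c - g Y)
      + (a * f X + (1 - a) * f Y - p) * (g X - g Y).
    transitivity ((p - f X) * (c - g Y) + (f X * (a * (g X - g Y))
      + f Y * ((g X - g Y) - a * (g X - g Y)) - p * (g X - g Y))); last by ring.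
    by rewrite aE; ring.
  by rewrite lerDl mulr_ge0 ?subr_ge0// ltW// (lt_trans Yc).
(* Including 0 makes the set nonempty and its supremum nonnegative; the Slater point bounds it
   above. *)
pose E := [set e | e = 0 \/ exists2 X, S X /\ c < g X & e = (p - f X) / (g X - c)].
have ubE Y : S Y -> g Y < c -> ubound E ((f Y - p) / (c - g Y)).
  move=> SY Yc _ [->|[X [SX cX] ->]]; last exact: key.
  by rewrite divr_ge0// ?subr_ge0 ?pmin// ltW.
have E0 : E 0 by left.
have supE : has_sup E by split; [exists 0|exists ((f X0 - p) / (c - g X0)); exact: ubE].
exists (sup E); first exact: sup_upper_bound.
move=> X SX; have [Xc|cX|Xc] := ltgtP (g X) c.
- have : sup E <= (f X - p) / (c - g X) by apply: ge_sup; [exists 0|exact: ubE].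
  by rewrite ler_pdivlMr ?subr_gt0//; lra.
- have : (p - f X) / (g X - c) <= sup E.
    by apply: sup_upper_bound => //; right; exists X.
  by rewrite ler_pdivrMr ?subr_gt0//; lra.
- by rewrite Xc subrr mulr0 addr0 pmin// Xc.
Qed.

(** * Convexity of the attainable values and strong duality *)

Section Duality.
Context {R : realType} {d : measure_display} {T : measurableType d}.
Variable P : probability T R.
Variables (n m : nat) (A : 'M[R]_n) (B : 'M[R]_(n, m)).
Variables (Q : 'M[R]_n) (Rc : 'M[R]_m).
Variables (x0 : T -> 'cV[R]_n) (w : nat -> T -> 'cV[R]_n).
Hypothesis w_iid : iid P w.
Hypothesis w_L2 : forall t, mxLfun P 2 (w t).
Hypothesis x0_L2 : mxLfun P 2 x0.
Local Notation W := (covmx P (w 0%N)).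
Hypothesis W_pd : pd W.
Hypothesis Q_psd : psd Q.
Hypothesis Rc_psd : psd Rc.
Local Notation J := (J P A B Q Rc x0 w).
Local Notation Jc := (Jc P A B Q x0 w).

Let QWQ_psd : psd (Q *m W *m Q).
Proof. by rewrite -{2}(proj1 Q_psd); exact: psd_congr (pd_psd W_pd). Qed.

Lemma stationary_exists (X : policy R n m) : stabilizing A B X ->
  exists xb S, [/\ equilibrium P A B w X xb, S = congr_mx (A - B *m X.1) S + W,
    J X = (stationary_cost Q Rc X xb S)%:E & Jc X = (stationary_risk P Q w xb S)%:E].
Proof.
move=> /spectral_radius_powers_vanish F0.
have [S SE] := lyapunov_exists W F0.
pose xb := invmx (1%:M - (A - B *m X.1)) *m (B *m X.2 + Emx P (w 0%N)).
have xbE : equilibrium P A B w X xb.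
  have := mulKVmx (powers_vanish_unit F0) (B *m X.2 + Emx P (w 0%N)).
  rewrite -/xb mulmxBl mul1mx => /eqP; rewrite subr_eq => /eqP; move: (xb) => y yE.
  rewrite /equilibrium {1}yE /control mulmxDr mulmxN mulmxA mulmxBl.
  by rewrite [LHS]addrC -!addrA.
have W_psd := pd_psd W_pd.
exists xb, S; split => //; [exact: J_stationary|exact: Jc_stationary].
Qed.

(** Both costs are finite on stabilizing policies, so [fine] loses nothing. The gain comes from
    [stationary_convex], the offset from the averaged equilibrium. *)
Lemma values_convex (a : R) (X Y : policy R n m) : 0 <= a -> a <= 1 ->
  stabilizing A B X -> stabilizing A B Y ->
  exists Z, [/\ stabilizing A B Z,
    fine (J Z) <= a * fine (J X) + (1 - a) * fine (J Y)
    & fine (Jc Z) <= a * fine (Jc X) + (1 - a) * fine (Jc Y)].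
Proof.
move=> a0 a1 stX stY.
have [x1 [S1 [x1E S1E -> ->]]] := stationary_exists stX.
have [x2 [S2 [x2E S2E -> ->]]] := stationary_exists stY.
have [K [S [stK SE trS trK]]] := stationary_convex W_pd a0 a1 stX stY S1E S2E.
pose xb := a *: x1 + (1 - a) *: x2.
pose ub := a *: control X x1 + (1 - a) *: control Y x2.
(* The offset is chosen so that the input at [xb] is [ub], whatever the gain [K]. *)
pose Z : policy R n m := (K, ub + K *m xb).
have ZE : control Z xb = ub by rewrite /control /= addrC addrK.
(* The equilibrium equation is affine in state and input together, so it survives averaging. *)
have xbE : equilibrium P A B w Z xb.
  rewrite /equilibrium ZE.
  have {1}-> : Emx P (w 0%N) = a *: Emx P (w 0%N) + (1 - a) *: Emx P (w 0%N).
    by rewrite -scalerDl addrC subrK scale1r.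
  move: x1E x2E; rewrite /xb /ub /equilibrium.
  move: (control X x1) (control Y x2) => u1 u2 x1E x2E.
  rewrite {1}x1E {1}x2E !mulmxDr -!scalemxAr !scalerDr.
  by rewrite addrACA [X in X + _ = _]addrACA.
have F0 : powers_vanish (A - B *m Z.1) by exact: spectral_radius_powers_vanish.
have W_psd := pd_psd W_pd.
exists Z; split => //.
- rewrite (J_stationary Q Rc w_iid w_L2 x0_L2 W_psd F0 xbE SE) /= /stationary_cost ZE.
  have h1 := qform_convex x1 x2 Q_psd a0 a1; rewrite -/xb in h1.
  have h2 := qform_convex (control X x1) (control Y x2) Rc_psd a0 a1; rewrite -/ub in h2.
  have h3 := trS _ Q_psd; have h4 := trK _ Rc_psd; rewrite /= in h4 *.
  have h := lerD (lerD (lerD h1 h2) h3) h4.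
  by apply: le_trans h _; rewrite le_eqVlt; apply/orP; left; apply/eqP; rewrite /=; ring.
- rewrite (Jc_stationary Q w_iid w_L2 x0_L2 W_psd F0 xbE SE) /= /stationary_risk.
  have h1 := qform_convex x1 x2 QWQ_psd a0 a1; rewrite -/xb in h1.
  have h2 : (xb^T *m Q *m M3 P Q (w 0%N)) 0 0 <=
      a * (x1^T *m Q *m M3 P Q (w 0%N)) 0 0
      + (1 - a) * (x2^T *m Q *m M3 P Q (w 0%N)) 0 0.
    rewrite /xb [(_ + _)^T]linearD /= ![(_ *: _)^T]linearZ /= !mulmxDl -!scalemxAl.
    by rewrite !mxE.
  have h3 := trS _ QWQ_psd.
  have h : 4 * _ <= 4 * _ := ler_wpM2l (ler0n _ _) (lerD (lerD h1 h2) h3).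
  by apply: le_trans h _; rewrite le_eqVlt; apply/orP; left; apply/eqP; rewrite /=; ring.
Qed.

Variable rho0 : R.

Lemma strong_duality :
  (exists X, stabilizing A B X /\ (Jc X < (rhobar P Q w rho0)%:E)%E) ->
  primal_value P A B Q Rc x0 w rho0 = dual_value P A B Q Rc x0 w rho0.
Proof.
move=> [X0 [stX0 riskX0]]; set c := rhobar _ _ _ _ in riskX0 *.
have Jfin X : stabilizing A B X -> J X = (fine (J X))%:E.
  by move=> /stationary_exists[xb [S [_ _ -> _]]].
have Jcfin X : stabilizing A B X -> Jc X = (fine (Jc X))%:E.
  by move=> /stationary_exists[xb [S [_ _ _ ->]]].
have LE mu X : stabilizing A B X -> lagrangian P A B Q Rc x0 w rho0 X mu =
    (fine (J X) + mu * (fine (Jc X) - c))%:E.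
  by move=> st; rewrite /lagrangian (Jfin _ st) (Jcfin _ st).
(* Weak duality: on a feasible policy the multiplier term is nonpositive. *)
have weak : (dual_value P A B Q Rc x0 w rho0 <= primal_value P A B Q Rc x0 w rho0)%E.
  apply: ge_ereal_sup => _ [mu /= mu0 <-].
  apply: le_ereal_inf_tmp => _ [X [/= st riskX] <-].
  apply: (@le_trans _ _ (lagrangian P A B Q Rc x0 w rho0 X mu)).
    by apply: ereal_inf_lbound; exists X.
  rewrite LE// Jfin// lee_fin gerDl mulr_ge0_le0// subr_le0.
  by rewrite -lee_fin -Jcfin.
apply/eqP; rewrite eq_le weak andbT.
have feas0 : (Jc X0 <= c%:E)%E by exact: ltW.
have primal_le X : stabilizing A B X -> (Jc X <= c%:E)%E ->
    (primal_value P A B Q Rc x0 w rho0 <= J X)%E.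
  by move=> st rX; apply: ereal_inf_lbound; exists X.
(* The value [-oo] is below any dual value, and the Slater point rules out [+oo]; a finite [p] calls
   for a multiplier. *)
case pE : (primal_value P A B Q Rc x0 w rho0) => [p| |]; last first.
- by rewrite leNye.
- by have := primal_le _ stX0 feas0; rewrite pE Jfin.
have [|||mu mu0 hmu] := @lagrange_multiplier R _ (stabilizing A B)
  (fun X => fine (J X)) (fun X => fine (Jc X)) p c.
- by move=> a X Y a0 a1 stX stY; exact: values_convex.
- by exists X0 => //; rewrite -lte_fin -Jcfin.
- move=> X st rX; rewrite -lee_fin -pE -(Jfin _ st); apply: primal_le => //.
  by rewrite Jcfin// lee_fin.
(* The multiplier bounds every Lagrangian value at [mu] below by [p], so the dual function reaches
   [p] there. *)
apply: (@le_trans _ _ (dual_function P A B Q Rc x0 w rho0 mu)).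
  apply: le_ereal_inf_tmp => _ [X st <-].
  by rewrite LE// lee_fin; exact: hmu.
by apply: ereal_sup_ubound; exists mu.
Qed.

End Duality.

Theorem theorem2 (R : realType) (d : measure_display)
    (Omega : measurableType d) (P : probability Omega R) (n m : nat)
    (A : 'M[R]_n) (B : 'M[R]_(n, m)) (Q Qhalf : 'M[R]_n) (Rc : 'M[R]_m)
    (x0 : Omega -> 'cV[R]_n) (w : nat -> Omega -> 'cV[R]_n) (rho0 : R)
    (x0_rv : random_vector x0) (x0_moment2 : finite_even_moment P 1 x0)
    (w_iid : iid P w) (w_moment4 : forall t, finite_even_moment P 2 (w t))
    (W_pd : pd (covmx P (w 0%N)))
    (Q_psd : psd Q) (Rc_pd : pd Rc)
    (AB_controllable : controllable A B)
    (Q_sqrt : is_sqrtmx Q Qhalf) (AQ_observable : observable A Qhalf)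
    (rho0_gt0 : 0 < rho0)
    (slater : exists X : policy R n m,
        stabilizing A B X /\
        (Jc P A B Q x0 w X < (rhobar P Q w rho0)%:E)%E) :
  primal_value P A B Q Rc x0 w rho0 = dual_value P A B Q Rc x0 w rho0.
Proof.
have [w_rv _ _] := w_iid.
have x0_L2 := finite_even_moment_mxLfun (ltnSn 0) x0_rv x0_moment2.
have w_L2 t := finite_even_moment_mxLfun (ltn0Sn 1) (w_rv t) (w_moment4 t).
exact: (strong_duality w_iid w_L2 x0_L2 W_pd Q_psd (pd_psd Rc_pd) slater).
Qed.
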